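(* Let $\mathcal{X}$ be an instance of the resource sharing problem (as described in the context) and let $\delta\in(0,1]$. One can compute a primal solution $x\in\mathcal{X}$ and a dual solution $z\in\Delta_m$ satisfying \[\|x\|_\infty\le(1+\delta)\sigma\lambda^*,\qquad \min_{x'\in\mathcal{X}}\langle z,x'\rangle\ge(1-\delta)\frac{\lambda^*}{\sigma},\] and \[\max_{r\in S}x_r\le\mu+\delta\max\{\lambda^*,\mu\}\quad\text{for all } S\subseteq\mathcal{R},\ \mu\ge 0 \text{ such that } \mathcal{X} \text{ satisfies local weak duality w.r.t. } S \text{ and } \mu,\] using $\mathcal{O}\!\left(\frac{n+m}{\delta^2}\log m\right)$ oracle calls and further operations taking polynomial time.
   Context: Resource sharing problem: $\mathcal{C}$ (customers) and $\mathcal{R}$ (resources) are finite sets, $n=|\mathcal{C}|$, $m=|\mathcal{R}|$. For each $C\in\mathcal{C}$, $X_C\subseteq\mathbb{R}^{\mathcal{R}}_{\ge0}$ is a nonempty closed convex set, and $\mathcal{X}=\sum_{C\in\mathcal{C}}X_C$ is their Minkowski sum. For $y\in\mathbb{R}^m_{\ge0}$ let $opt_C(y)=\min_{x\in X_C}\langle y,x\rangle$. A constant $\sigma\ge1$ is fixed (regarded as a constant in the $\mathcal{O}$-notation), and for each $C$ an oracle (block solver) $f_C:\mathbb{R}^m_{\ge0}\to X_C$ is given with $\langle y,f_C(y)\rangle\le\sigma\,opt_C(y)$ for all $y\in\mathbb{R}^m_{\ge0}$; one evaluation of some $f_C$ is an oracle call. $\lambda^*=\min_{x\in\mathcal{X}}\|x\|_\infty$.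 $\Delta_m=\{p\in[0,1]^m:\|p\|_1=1\}$. The instance satisfies local weak duality w.r.t. $S\subseteq\mathcal{R}$ and $\mu\ge0$ if for every family $(y^{(C)})_{C\in\mathcal{C}}$ of vectors in $\mathbb{R}^m_{\ge0}$, $\sum_{C\in\mathcal{C}}\sum_{r\in S}y^{(C)}_r f_C(y^{(C)})_r\le\mu\sum_{r\in S}\max_{C\in\mathcal{C}}y^{(C)}_r$. *)

(* Defs.v *)
From HB Require Import structures.
From mathcomp Require Import all_boot all_order all_algebra.
From mathcomp Require Import all_classical all_reals all_analysis.

Set Implicit Arguments.
Unset Strict Implicit.
Unset Printing Implicit Defensive.

Import Order.TTheory GRing.Theory Num.Theory.
Import numFieldNormedType.Exports.

Local Open Scope classical_set_scope.
Local Open Scope ring_scope.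

(* Customers are 'I_n and resources are 'I_m; the norm `|x| that the library  *)
(* puts on 'rV[R]_m is the sup norm.                                          *)

Section ResourceSharing.
Variables (R : realType) (n m : nat).
Implicit Types (X : 'I_n -> set 'rV[R]_m) (f : 'I_n -> 'rV[R]_m -> 'rV[R]_m).
Implicit Types (x y z : 'rV[R]_m).

Definition dotr y x : R := \sum_(r < m) y 0 r * x 0 r.

Definition nonneg_vec x : Prop := forall r, 0 <= x 0 r.

Definition rs_instance X : Prop :=
  forall C, [/\ X C !=set0, closed (X C), convex_set (X C)
              & X C `<=` nonneg_vec].

Definition minkowski_sum X : set 'rV[R]_m :=
  [set x | exists2 g : 'I_n -> 'rV[R]_m,
             forall C, X C (g C) & x = \sum_C g C].

(* Minima are rendered by inf. Under rs_instance the sets concerned are       *)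
(* nonempty and bounded below by 0, and inf is the minimum whenever the       *)
(* minimum exists (it always does for lambda_star; for a linear form it need  *)
(* not, as X C may be unbounded).                                             *)
Definition min_dot (A : set 'rV[R]_m) y : R := inf [set dotr y x | x in A].

Definition opt X (C : 'I_n) y : R := min_dot (X C) y.

Definition lambda_star X : R := inf [set `|x| | x in minkowski_sum X].

Definition block_solver (sigma : R) X f : Prop :=
  forall C y, nonneg_vec y ->
    X C (f C y) /\ dotr y (f C y) <= sigma * opt X C y.

Definition simplex : set 'rV[R]_m :=
  [set p | (forall r, 0 <= p 0 r <= 1) /\ \sum_(r < m) `|p 0 r| = 1].

(* The default value 0 of the maximum over customers only matters for n = 0.  *)
Definition local_weak_duality f (S : {set 'I_m}) (mu : R) : Prop :=
  forall y : 'I_n -> 'rV[R]_m, (forall C, nonneg_vec (y C)) ->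
    \sum_C \sum_(r in S) y C 0 r * f C (y C) 0 r
      <= mu * \sum_(r in S) \big[Num.max/0]_C y C 0 r.

End ResourceSharing.

(* Computation model: a uniform real random-access machine with an oracle,    *)
(* given as a while language. The memory has natural-number registers, with   *)
(* addition and truncated subtraction only (so that unit cost is not abused), *)
(* and real arrays, with exact field operations and comparisons. A program    *)
(* contains no real constants other than numerals.                            *)
Inductive iexpr : Type :=
| ICst of nat
| IVar of nat
| IAdd of iexpr & iexpr
| ISub of iexpr & iexpr.

Inductive rexpr : Type :=
| RCst of nat
| RGet of nat & iexpr
| RAdd of rexpr & rexpr
| RSub of rexpr & rexpr
| RMul of rexpr & rexpr
| RDiv of rexpr & rexpr.

Inductive bexpr : Type :=
| BILt of iexpr & iexpr
| BRLt of rexpr & rexpr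
| BNot of bexpr
| BAnd of bexpr & bexpr.

(* Call e q a passes the first m entries of array q to the oracle of customer *)
(* number e and overwrites the first m entries of array a by the answer.      *)
Inductive cmd : Type :=
| Skip
| ISet of nat & iexpr
| RSet of nat & iexpr & rexpr
| Seq of cmd & cmd
| If of bexpr & cmd & cmd
| While of bexpr & cmd
| Call of iexpr & nat & nat.

Section Semantics.
Variables (R : realType) (n m : nat) (f : 'I_n -> 'rV[R]_m -> 'rV[R]_m).

Record state : Type := State { ivar : nat -> nat; rmem : nat -> nat -> R }.

Definition set_ivar (s : state) (v k : nat) : state :=
  State (fun w => if w == v then k else ivar s w) (rmem s).

Definition set_rmem (s : state) (a i : nat) (u : R) : state :=
  State (ivar s)
    (fun b j => if (b == a) && (j == i) then u else rmem s b j).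

Definition read_vec (s : state) (a : nat) : 'rV[R]_m :=
  \row_(r < m) rmem s a r.

Definition write_vec (s : state) (a : nat) (v : 'rV[R]_m) : state :=
  State (ivar s)
    (fun b j => if b == a then
                  if insub j is Some r then v 0 (r : 'I_m) else rmem s b j
                else rmem s b j).

Fixpoint ieval (s : state) (e : iexpr) : nat :=
  match e with
  | ICst k => k
  | IVar v => ivar s v
  | IAdd e1 e2 => (ieval s e1 + ieval s e2)%N
  | ISub e1 e2 => (ieval s e1 - ieval s e2)%N
  end.

Fixpoint reval (s : state) (e : rexpr) : R :=
  match e with
  | RCst k => k%:R
  | RGet a i => rmem s a (ieval s i)
  | RAdd e1 e2 => reval s e1 + reval s e2
  | RSub e1 e2 => reval s e1 - reval s e2
  | RMul e1 e2 => reval s e1 * reval s e2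
  | RDiv e1 e2 => reval s e1 / reval s e2
  end.

Fixpoint beval (s : state) (b : bexpr) : bool :=
  match b with
  | BILt e1 e2 => (ieval s e1 < ieval s e2)%N
  | BRLt e1 e2 => reval s e1 < reval s e2
  | BNot b1 => ~~ beval s b1
  | BAnd b1 b2 => beval s b1 && beval s b2
  end.

(* exec c s s' t q: started in s, c halts in s' after t elementary steps, of  *)
(* which q are oracle calls. One step is charged per command and per test;    *)
(* the expressions evaluated in a step have a size fixed by the program. A    *)
(* call to a nonexistent customer or with a negative price is stuck.          *)
Inductive exec : cmd -> state -> state -> nat -> nat -> Prop :=
| ExecSkip s : exec Skip s s 1 0
| ExecISet s v e : exec (ISet v e) s (set_ivar s v (ieval s e)) 1 0
| ExecRSet s a i e :
    exec (RSet a i e) s (set_rmem s a (ieval s i) (reval s e)) 1 0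
| ExecSeq c1 c2 s s1 s2 t1 t2 q1 q2 :
    exec c1 s s1 t1 q1 -> exec c2 s1 s2 t2 q2 ->
    exec (Seq c1 c2) s s2 (t1 + t2) (q1 + q2)
| ExecIfTrue b c1 c2 s s' t q :
    beval s b -> exec c1 s s' t q -> exec (If b c1 c2) s s' t.+1 q
| ExecIfFalse b c1 c2 s s' t q :
    ~~ beval s b -> exec c2 s s' t q -> exec (If b c1 c2) s s' t.+1 q
| ExecWhileFalse b c s : ~~ beval s b -> exec (While b c) s s 1 0
| ExecWhileTrue b c s s1 s2 t1 t2 q1 q2 :
    beval s b -> exec c s s1 t1 q1 -> exec (While b c) s1 s2 t2 q2 ->
    exec (While b c) s s2 (t1 + t2).+1 (q1 + q2)
| ExecCall e q a s (C : 'I_n) :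
    ieval s e = C -> nonneg_vec (read_vec s q) ->
    exec (Call e q a) s (write_vec s a (f C (read_vec s q))) 1 1.

(* Registers 0 and 1 hold n and m, entry 0 of array 0 holds delta, and the    *)
(* rest of the memory is 0.                                                   *)
Definition init_state (delta : R) : state :=
  State (fun v => match v with 0%N => n | 1%N => m | _ => 0%N end)
        (fun a i => if (a == 0%N) && (i == 0%N) then delta else 0).

(* On input n, m, delta and with oracle access to f, the program P returns x  *)
(* in array 1 and z in array 2, within t steps of which q are oracle calls.   *)
Definition computes (P : cmd) (delta : R) (x z : 'rV[R]_m) (t q : nat) : Prop :=
  exists s : state, [/\ exec P (init_state delta) s t q,
                        x = read_vec s 1 & z = read_vec s 2].

End Semantics.

(* Main.v *)
Require Import Defs.
From mathcomp Require Import all_boot all_order all_algebra.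
From mathcomp Require Import all_classical all_reals all_analysis.
From mathcomp Require Import ring lra zify.

(** A multiplicative-weights scheme. Prices y start at 1; a phase gives every
    customer C the total weight w, in steps: C answers b = f_C(y), a step size
    xi <= 1 / max_r b_r is chosen, the load x grows by xi b and y_r is multiplied
    by 1 + e xi b_r. Since y only grows within a phase, local weak duality
    w.r.t. (S, mu) bounds the growth of sum_(r in S) y_r over a phase by the
    factor 1 / (1 - e w mu), whereas y_r >= exp (e / (1 + e) x_r);
    comparing the two bounds x_r / W for r in S, where W is the total weight.
    The bound on the maximum norm is the case of S = all resources and
    mu = sigma lambda_star. The dual solution is the normalised price vector after
    the phase in which the sum of the prices grew by the largest factor. A step
    that does not finish its customer increases some load by 1, so the loads
    also bound the number of calls.

    The weight w must be of order 1 / lambda_star. To find it without a logarithmic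
    loss, the scheme is first run with e = 1, starting from a w that is too
    large by a factor O(m); a phase in which the sum of the prices more than
    doubles is aborted, which certifies that w is too large, and w is halved
    while prices and loads are kept. This stops when W >= w log m: there are
    only O(log m) aborted phases, and the loads being O(log m) then show that
    w = O(1 / lambda_star). *)

Set Implicit Arguments.
Unset Strict Implicit.
Unset Printing Implicit Defensive.

Import Order.TTheory GRing.Theory Num.Theory.
Import numFieldNormedType.Exports.

Local Open Scope classical_set_scope.
Local Open Scope ring_scope.

Section RealFacts.
Variable R : realType.
Implicit Types e a t : R.

Lemma expR_le_inv1B t : t < 1 -> expR t <= (1 - t)^-1.
Proof.
move=> t_lt1; rewrite -[t in expR t]opprK expRN lef_pV2 ?posrE ?expR_gt0 ?subr_gt0 //.
exact: (expR_ge1Dx (- t)).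
Qed.

Lemma inv1B_le_expR t : t < 1 -> (1 - t)^-1 <= expR (t / (1 - t)).
Proof.
move=> t_lt1; rewrite [leLHS](_ : _ = 1 + t / (1 - t)) ?expR_ge1Dx //.
by field; rewrite subr_eq0 gt_eqF.
Qed.

Lemma expR_le_1Dmul e a : 0 < e -> 0 <= a <= 1 ->
  expR (e / (1 + e) * a) <= 1 + e * a.
Proof.
move=> e_gt0 /andP[a_ge0 a_le1].
set h := e / (1 + e).
have hE : h * (1 + e) = e by rewrite divfK // gt_eqF // addr_gt0.
have h_gt0 : 0 < h by rewrite divr_gt0 // addr_gt0.
have ha_lt1 : h * a < 1 by nra.
apply: le_trans (expR_le_inv1B ha_lt1) _.
rewrite -div1r ler_pdivrMr ?subr_gt0 //.
have -> : (1 + e * a) * (1 - h * a) = 1 + a * (e - h * (1 + e) + h * e * (1 - a)).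
  by ring.
by rewrite hE subrr add0r lerDl mulr_ge0 // mulr_ge0 ?subr_ge0 // ltW // mulr_gt0.
Qed.

Lemma ln2_ge_half : 2^-1 <= ln 2 :> R.
Proof.
have half_lt1 : 2^-1 < 1 :> R by lra.
rewrite -ler_expR lnK ?posrE //; apply: le_trans (expR_le_inv1B half_lt1) _.
by rewrite (_ : 1 - 2^-1 = 2^-1) ?invrK //; lra.
Qed.

Lemma ln_natr_le_log k l : (0 < k)%N -> (k <= 2 ^ l)%N -> ln k%:R <= l%:R :> R.
Proof.
move=> k_gt0 k_le; apply: (@le_trans _ _ (ln (2 ^ l)%:R)).
  by rewrite ler_ln ?posrE ?ltr0n ?expn_gt0 // ler_nat.
rewrite natrX lnXn // -[leRHS]mulr_natl mulr1 -[leLHS]mulr_natl ler_piMr //.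
by rewrite -[2]/(1 + 1) le_ln1Dx //; lra.
Qed.

End RealFacts.

Lemma sum_setT (V : nmodType) (I : finType) (F : I -> V) :
  \sum_(i in [set: I]%SET) F i = \sum_i F i.
Proof. by apply: eq_bigl => i; rewrite inE. Qed.

Lemma ler_sum_coord (R : numDomainType) (I : finType) (F : I -> R) i :
  (forall j, 0 <= F j) -> F i <= \sum_j F j.
Proof. by move=> F_ge0; rewrite (bigD1 i) //= lerDl sumr_ge0. Qed.

Lemma coord_le_norm (R : realFieldType) m n (x : 'M[R]_(m, n)) i j : `|x i j| <= `|x|.
Proof.
rewrite [leRHS]/Num.norm /= mx_normrE.
exact: (le_bigmax _ (fun ij : 'I_m * 'I_n => `|x ij.1 ij.2|) (i, j)).
Qed.

Lemma norm_le_coord (R : realFieldType) m n (x : 'M[R]_(m, n)) e :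
  0 <= e -> (forall i j, `|x i j| <= e) -> `|x| <= e.
Proof.
move=> e_ge0 x_le; rewrite [leLHS]/Num.norm /= mx_normrE.
by apply/bigmax_leP; split.
Qed.

Section LinearForms.
Variables (R : realType) (m : nat).
Implicit Types x y : 'rV[R]_m.

Lemma dotr_ge0 y x : nonneg_vec y -> nonneg_vec x -> 0 <= dotr y x.
Proof. by move=> y_ge0 x_ge0; apply: sumr_ge0 => r _; rewrite mulr_ge0. Qed.

Lemma dotr_sumr (I : finType) y (x : I -> 'rV[R]_m) :
  dotr y (\sum_i x i) = \sum_i dotr y (x i).
Proof.
rewrite /dotr exchange_big /=; apply: eq_bigr => r _.
by rewrite summxE mulr_sumr.
Qed.

Lemma dotrZl c y x : dotr (c *: y) x = c * dotr y x.
Proof. by rewrite /dotr mulr_sumr; apply: eq_bigr => r _; rewrite mxE mulrA. Qed.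

Lemma dotr_le_norm y x : nonneg_vec y -> dotr y x <= `|x| * \sum_r y 0 r.
Proof.
move=> y_ge0; rewrite /dotr mulr_sumr; apply: ler_sum => r _.
rewrite mulrC ler_wpM2r //; apply: le_trans (coord_le_norm x 0 r).
exact: ler_norm.
Qed.

Lemma simplex_normalize y :
  nonneg_vec y -> 0 < \sum_r y 0 r -> simplex ((\sum_r y 0 r)^-1 *: y).
Proof.
move=> y_ge0 y_gt0; split=> [r|].
  rewrite mxE mulr_ge0 ?invr_ge0 ?(ltW y_gt0) //=.
  by rewrite ler_pdivrMl // mulr1 ler_sum_coord.
rewrite -[RHS](mulVf (lt0r_neq0 y_gt0)) mulr_sumr; apply: eq_bigr => r _.
by rewrite mxE ger0_norm // mulr_ge0 ?invr_ge0 // ltW.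
Qed.

Variable A : set 'rV[R]_m.
Hypothesis A_neq0 : A !=set0.
Hypothesis A_ge0 : A `<=` @nonneg_vec R m.

Lemma min_dot_le y x : nonneg_vec y -> A x -> min_dot A y <= dotr y x.
Proof.
move=> y_ge0 Ax; apply: ge_inf; last by exists x.
by exists 0 => _ [x' /A_ge0 x'_ge0 <-]; exact: dotr_ge0.
Qed.

Lemma le_min_dot y e : (forall x, A x -> e <= dotr y x) -> e <= min_dot A y.
Proof.
move=> e_le; have [x Ax] := A_neq0.
apply: lb_le_inf; first by exists (dotr y x), x.
by move=> _ [x' Ax' <-]; exact: e_le.
Qed.

Lemma min_dot_ge0 y : nonneg_vec y -> 0 <= min_dot A y.
Proof. by move=> y_ge0; apply: le_min_dot => x /A_ge0; exact: dotr_ge0. Qed.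

Lemma le_min_dotr y y' : nonneg_vec y -> (forall r, y 0 r <= y' 0 r) ->
  min_dot A y <= min_dot A y'.
Proof.
move=> y_ge0 yy'; apply: le_min_dot => x Ax; apply: le_trans (min_dot_le y_ge0 Ax) _.
by apply: ler_sum => r _; rewrite ler_wpM2r // A_ge0.
Qed.

Lemma min_dotZ c y : 0 < c -> nonneg_vec y -> min_dot A (c *: y) = c * min_dot A y.
Proof.
move=> c_gt0 y_ge0.
have cy_ge0 : nonneg_vec (c *: y) by move=> r; rewrite mxE mulr_ge0 // ltW.
apply/eqP; rewrite eq_le; apply/andP; split.
  rewrite -ler_pdivrMl //; apply: le_min_dot => x Ax.
  by rewrite ler_pdivrMl // -dotrZl min_dot_le.
by apply: le_min_dot => x Ax; rewrite dotrZl ler_pM2l // min_dot_le.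
Qed.

End LinearForms.

Section ResourceSharing.
Variables (R : realType) (n m : nat).
Variables (X : 'I_n -> set 'rV[R]_m) (f : 'I_n -> 'rV[R]_m -> 'rV[R]_m).
Variable sigma : R.
Hypothesis X_inst : rs_instance X.
Hypothesis f_solver : block_solver sigma X f.
Hypothesis sigma_ge1 : 1 <= sigma.
Implicit Types (x y b : 'rV[R]_m) (a : 'I_n -> R).

Lemma block_neq0 C : X C !=set0.
Proof. by have [] := X_inst C. Qed.

Lemma block_ge0 C : X C `<=` @nonneg_vec R m.
Proof. by have [] := X_inst C. Qed.

Lemma solver_in C y : nonneg_vec y -> X C (f C y).
Proof. by move=> y_ge0; have [] := f_solver C y_ge0. Qed.

Lemma solver_ge0 C y : nonneg_vec y -> nonneg_vec (f C y).
Proof. by move=> /(@solver_in C)/block_ge0. Qed.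

Lemma solver_le C y : nonneg_vec y -> dotr y (f C y) <= sigma * opt X C y.
Proof. by move=> y_ge0; have [] := f_solver C y_ge0. Qed.

Lemma minkowski_sum_ge0 x : minkowski_sum X x -> nonneg_vec x.
Proof.
move=> [g Xg ->] r; rewrite summxE; apply: sumr_ge0 => C _; exact: block_ge0 (Xg C) r.
Qed.

Lemma minkowski_sum_neq0 : minkowski_sum X !=set0.
Proof. by have [g Xg] := choice block_neq0; exists (\sum_C g C), g. Qed.

Lemma sum_opt_le_min_dot y : nonneg_vec y ->
  \sum_C opt X C y <= min_dot (minkowski_sum X) y.
Proof.
move=> y_ge0; apply: (le_min_dot minkowski_sum_neq0) => _ [g Xg ->].
rewrite dotr_sumr; apply: ler_sum => C _. 
exact: (min_dot_le (@block_ge0 C) y_ge0 (Xg C)).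
Qed.

Lemma le_lambda e : (forall x, minkowski_sum X x -> e <= `|x|) -> e <= lambda_star X.
Proof.
move=> e_le; have [x Xx] := minkowski_sum_neq0.
apply: lb_le_inf; first by exists `|x|, x.
by move=> _ [x' Xx' <-]; exact: e_le.
Qed.

Lemma lambda_ge0 : 0 <= lambda_star X.
Proof. exact: le_lambda. Qed.

Lemma lambda_le_coord x e : minkowski_sum X x -> 0 <= e ->
  (forall r, x 0 r <= e) -> lambda_star X <= e.
Proof.
move=> Xx e_ge0 x_le; apply: (@le_trans _ _ `|x|).
  by apply: ge_inf; [exists 0 => _ [u _ <-]|exists x].
apply: norm_le_coord => // i r.
by rewrite (ord1 i) ger0_norm // (minkowski_sum_ge0 Xx).
Qed.

Lemma sum_opt_le y : nonneg_vec y -> \sum_C opt X C y <= lambda_star X * \sum_r y 0 r.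
Proof.
move=> y_ge0.
have opt_le_norm x : minkowski_sum X x -> \sum_C opt X C y <= `|x| * \sum_r y 0 r.
  move=> Xx; apply: le_trans (dotr_le_norm x y_ge0).
  apply: le_trans (sum_opt_le_min_dot y_ge0) _.
  exact: (min_dot_le minkowski_sum_ge0).
have [y_sum0|y_sum_neq0] := eqVneq (\sum_r y 0 r) 0.
  by have [x /opt_le_norm] := minkowski_sum_neq0; rewrite y_sum0 !mulr0.
have y_sum_gt0 : 0 < \sum_r y 0 r by rewrite lt_neqAle eq_sym y_sum_neq0 sumr_ge0.
rewrite -ler_pdivrMr //; apply: le_lambda => x /opt_le_norm.
by rewrite ler_pdivrMr.
Qed.

(* Replacing every price vector by their coordinatewise maximum u only increases
   the optima, and the optima at u sum to at most lambda_star times the sum of u. *)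
Lemma weak_duality_setT :
  local_weak_duality f [set: 'I_m]%SET (sigma * lambda_star X).
Proof.
move=> y y_ge0; pose u : 'rV[R]_m := \row_r \big[Num.max/0]_C y C 0 r.
have u_ge0 : nonneg_vec u by move=> r; rewrite mxE bigmax_ge_id.
have y_le_u C r : y C 0 r <= u 0 r.
  by rewrite mxE; exact: (le_bigmax _ (fun D => y D 0 r) C).
rewrite sum_setT (eq_bigr (fun r => u 0 r)) => [|r _]; last by rewrite mxE.
apply: (@le_trans _ _ (sigma * \sum_C opt X C u)); last first.
  by rewrite -mulrA ler_wpM2l ?sum_opt_le // (le_trans ler01).
rewrite mulr_sumr; apply: ler_sum => C _; rewrite sum_setT.
apply: le_trans (solver_le C (y_ge0 C)) _.
rewrite ler_wpM2l ?(le_trans ler01) //.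
exact: (le_min_dotr (@block_neq0 C) (@block_ge0 C)).
Qed.

Definition weighted_sum a : set 'rV[R]_m :=
  [set x | exists2 p : 'I_n -> 'rV[R]_m,
             forall C, X C (p C) & x = \sum_C a C *: p C].

Lemma weighted_sum0 : weighted_sum (fun=> 0) 0.
Proof.
have [p Xp] := choice block_neq0; exists p => //.
by rewrite big1 // => C _; rewrite scale0r.
Qed.

Lemma weighted_sum_ge0 a x : (forall C, 0 <= a C) -> weighted_sum a x -> nonneg_vec x.
Proof.
move=> a_ge0 [p Xp ->] r; rewrite summxE; apply: sumr_ge0 => C _.
by rewrite mxE mulr_ge0 // (block_ge0 (Xp C)).
Qed.

Lemma weighted_sum_cst W x : 0 < W ->
  weighted_sum (fun=> W) x -> minkowski_sum X (W^-1 *: x).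
Proof.
move=> W_gt0 [p Xp ->]; exists p => //; rewrite scaler_sumr.
by apply: eq_bigr => C _; rewrite scalerA mulVf ?gt_eqF // scale1r.
Qed.

Lemma weighted_sum_le a a' x : (forall C, a' C <= a C) -> weighted_sum a x ->
  exists2 x', weighted_sum a' x' & forall r, x' 0 r <= x 0 r.
Proof.
move=> a'a [p Xp ->]; exists (\sum_C a' C *: p C); first by exists p.
move=> r; rewrite !summxE; apply: ler_sum => C _.
by rewrite !mxE ler_wpM2r // (block_ge0 (Xp C)).
Qed.

Lemma block_weighted_mean C p b c d : 0 <= c -> 0 < d -> X C p -> X C b ->
  exists2 q, X C q & c *: p + d *: b = (c + d) *: q.
Proof.
move=> c_ge0 d_gt0 Xp Xb; have [_ _ convexX _] := X_inst C.
have cd_gt0 : 0 < c + d by rewrite ltr_wpDl.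
have ratio_ge0 : 0 <= c / (c + d) by rewrite divr_ge0 // ltW.
have ratio_le1 : c / (c + d) <= 1 by rewrite ler_pdivrMr // mul1r lerDl ltW.
exists ((c / (c + d)) *: p + (d / (c + d)) *: b).
  have := convexX p b (Itv01 ratio_ge0 ratio_le1) (mem_set Xp) (mem_set Xb).
  rewrite inE /conv /= /unstable.onem.
  suff -> : 1 - c / (c + d) = d / (c + d) by [].
  by field; rewrite gt_eqF.
by rewrite scalerDr !scalerA ![(c + d) * _]mulrC !divfK // gt_eqF.
Qed.

Lemma weighted_sumD a x (D : 'I_n) d b : 0 <= a D -> 0 < d -> X D b ->
  weighted_sum a x ->
  weighted_sum (fun C => a C + (if C == D then d else 0)) (x + d *: b).
Proof.
move=> aD_ge0 d_gt0 Xb [p Xp ->].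
have [q Xq qE] := block_weighted_mean aD_ge0 d_gt0 (Xp D) Xb.
exists (fun C => if C == D then q else p C) => [C|]; first by case: eqP => [->|].
rewrite (bigD1 D) //= [in RHS](bigD1 D) //= eqxx -qE addrAC; congr (_ + _).
by apply: eq_bigr => C /negbTE->; rewrite addr0.
Qed.

End ResourceSharing.

(** * The algorithm as a function on configurations *)

(* [completed], [aborted] and [calls] are only used in the analysis. Of
   [start_price], the prices at the start of the phase, the program stores
   the sum. *)
Record config (R : realType) (m : nat) : Type := Config {
  customer : nat;
  remaining : R;
  weight : R;
  total_weight : R;
  price : 'rV[R]_m;
  load : 'rV[R]_m;
  dual_candidate : 'rV[R]_m;
  best_growth : R;
  start_price : 'rV[R]_m;
  completed : nat;
  aborted : nat;
  calls : nat }.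

Definition max_coord (R : realType) m (b : 'rV[R]_m) : R := \big[Num.max/0]_r b 0 r.

Lemma max_coord_attained (R : realType) m (b : 'rV[R]_m) :
  0 < max_coord b -> exists r, b 0 r = max_coord b.
Proof.
move=> b_gt0.
case/bigmax_geP: (lexx (max_coord b)) => [|[r _ max_le]]; first by rewrite leNgt b_gt0.
by exists r; apply/eqP; rewrite eq_le max_le andbT (le_bigmax _ (fun r => b 0 r)).
Qed.

Section Algorithm.
Variables (R : realType) (n m : nat) (f : 'I_n -> 'rV[R]_m -> 'rV[R]_m) (e : R).
Implicit Types c : config R m.

Definition price_sum c : R := \sum_r price c 0 r.

Definition start_sum c : R := \sum_r start_price c 0 r.

Definition answer c : 'rV[R]_m :=
  if insub (customer c) is Some C then f C (price c) else 0.

(* The remaining weight would increase some load by more than 1. *)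
Definition limited c : bool := 1 < remaining c * max_coord (answer c).

Definition step_size c : R :=
  if limited c then (max_coord (answer c))^-1 else remaining c.

Definition oracle_step c : config R m := {|
  customer := if limited c then customer c else (customer c).+1;
  remaining := if limited c then remaining c - step_size c else weight c;
  weight := weight c;
  total_weight := total_weight c;
  price := \row_r (price c 0 r * (1 + e * (step_size c * answer c 0 r)));
  load := load c + step_size c *: answer c;
  dual_candidate := dual_candidate c;
  best_growth := best_growth c;
  start_price := start_price c;
  completed := completed c;
  aborted := aborted c;
  calls := (calls c).+1 |}.

Definition aborts c : bool := (1 + e) * start_sum c < price_sum c.

Definition abort_phase c : config R m := {|
  customer := 0;
  remaining := weight c / 2;
  weight := weight c / 2;
  total_weight := total_weight c;
  price := price c;
  load := load c;
  dual_candidate := dual_candidate c;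
  best_growth := best_growth c;
  start_price := price c;
  completed := completed c;
  aborted := (aborted c).+1;
  calls := calls c |}.

Definition phase_growth c : R := price_sum c / start_sum c.

Definition complete_phase c : config R m := {|
  customer := 0;
  remaining := weight c;
  weight := weight c;
  total_weight := total_weight c + weight c;
  price := price c;
  load := load c;
  dual_candidate := if best_growth c < phase_growth c
    then (price_sum c)^-1 *: price c else dual_candidate c;
  best_growth := Num.max (best_growth c) (phase_growth c);
  start_price := price c;
  completed := (completed c).+1;
  aborted := aborted c;
  calls := calls c |}.

Definition end_phase c : config R m :=
  if aborts c then abort_phase c
  else if (customer c < n)%N then c else complete_phase c.

Definition step c : config R m := end_phase (oracle_step c).

Definition initial w z : config R m := {|
  customer := 0;
  remaining := w;
  weight := w;
  total_weight := 0;
  price := const_mx 1;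
  load := 0;
  dual_candidate := z;
  best_growth := 0;
  start_price := const_mx 1;
  completed := 0;
  aborted := 0;
  calls := 0 |}.

Definition unfinished (Phi : R) c : bool := total_weight c < Phi * weight c.

Variant end_phase_spec c : config R m -> Prop :=
| EndPhaseAbort of aborts c : end_phase_spec c (abort_phase c)
| EndPhaseContinue of price_sum c <= (1 + e) * start_sum c & (customer c < n)%N :
    end_phase_spec c c
| EndPhaseComplete of price_sum c <= (1 + e) * start_sum c & (n <= customer c)%N :
    end_phase_spec c (complete_phase c).

Lemma end_phaseP c : end_phase_spec c (end_phase c).
Proof.
rewrite /end_phase; case: ifP => [|/negbT]; first exact: EndPhaseAbort.
rewrite /aborts -leNgt => no_abort.
by case: ltnP; [exact: EndPhaseContinue|exact: EndPhaseComplete].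
Qed.

Lemma answerE c (C : 'I_n) : customer c = C -> answer c = f C (price c).
Proof. by rewrite /answer => ->; rewrite valK. Qed.

End Algorithm.

(** * A single phase *)

Section Phase.
Variables (R : realType) (n m : nat).
Variables (X : 'I_n -> set 'rV[R]_m) (f : 'I_n -> 'rV[R]_m -> 'rV[R]_m).
Variable sigma : R.
Hypothesis X_inst : rs_instance X.
Hypothesis f_solver : block_solver sigma X f.
Hypothesis sigma_ge1 : 1 <= sigma.
Variable e : R.
Hypothesis e_gt0 : 0 < e.
Implicit Types (c : config R m) (S : {set 'I_m}).

Definition spent c (D : 'I_n) : R :=
  if (D < customer c)%N then weight c
  else if D == customer c :> nat then weight c - remaining c else 0.

Definition block_value S (D : 'I_n) (u : 'rV[R]_m) : R :=
  \sum_(r in S) u 0 r * f D u 0 r.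

(* For each customer D, u D is the price vector of the most expensive step. *)
Definition bounded_growth c : Prop := forall S,
  exists2 u : 'I_n -> 'rV[R]_m,
    forall D, nonneg_vec (u D) /\ (forall r, u D 0 r <= price c 0 r) &
    \sum_(r in S) price c 0 r - \sum_(r in S) start_price c 0 r
      <= e * \sum_D spent c D * block_value S D (u D).

(* Aborted phases leave loads that are not accounted for in [total_weight]. *)
Definition allocated c : Prop :=
  exists2 x, weighted_sum X (fun D => total_weight c + spent c D) x &
    (forall r, x 0 r <= load c 0 r) /\ (aborted c = 0%N -> x = load c).

Definition price_dominates_load c : Prop :=
  forall r, expR (e / (1 + e) * load c 0 r) <= price c 0 r.

Record phase_inv c : Prop := PhaseInv {
  phase_customer : (customer c <= n)%N;
  phase_remaining : 0 < remaining c <= weight c;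
  phase_total : 0 <= total_weight c;
  phase_price : forall r, 1 <= start_price c 0 r <= price c 0 r;
  phase_exp : price_dominates_load c;
  phase_bounded_growth : bounded_growth c;
  phase_allocated : allocated c }.

Lemma phase_weight_gt0 c : phase_inv c -> 0 < weight c.
Proof. by move=> /phase_remaining/andP[]; exact: lt_le_trans. Qed.

Lemma phase_price_ge1 c r : phase_inv c -> 1 <= price c 0 r.
Proof. by move=> /phase_price/(_ r)/andP[]; exact: le_trans. Qed.

Lemma phase_price_ge0 c : phase_inv c -> nonneg_vec (price c).
Proof. by move=> inv r; exact: le_trans (phase_price_ge1 r inv). Qed.

Lemma spent_bounds c D : phase_inv c -> 0 <= spent c D <= weight c.
Proof.
move=> /phase_remaining rem; rewrite /spent.
by case: ifP => _; [|case: ifP => _]; lra.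
Qed.

Lemma phase_load_ge0 c : phase_inv c -> nonneg_vec (load c).
Proof.
move=> inv r; have [x alloc [x_le _]] := phase_allocated inv.
apply: le_trans (x_le r); apply: (weighted_sum_ge0 X_inst _ alloc) => D.
by rewrite addr_ge0 ?(phase_total inv) //; case/andP: (spent_bounds D inv).
Qed.

Definition at_phase_start c : Prop :=
  [/\ customer c = 0%N, remaining c = weight c & start_price c = price c].

Lemma spent_start c D : at_phase_start c -> spent c D = 0.
Proof. by case=> C0 remE _; rewrite /spent C0 remE ltn0 subrr if_same. Qed.

Lemma spent_end c D : customer c = n -> spent c D = weight c.
Proof. by rewrite /spent => ->; rewrite ltn_ord. Qed.

Lemma bounded_growth_start c :
  at_phase_start c -> nonneg_vec (price c) -> bounded_growth c.
Proof.
move=> start price_ge0 S; exists (fun=> 0) => [D|].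
  by split=> r; rewrite mxE //; exact: price_ge0.
have [_ _ ->] := start.
by rewrite subrr big1 ?mulr0 // => D _; rewrite spent_start // mul0r.
Qed.

Lemma phase_inv_start c : at_phase_start c -> 0 < weight c -> 0 <= total_weight c ->
  (forall r, 1 <= price c 0 r) -> price_dominates_load c -> allocated c -> phase_inv c.
Proof.
move=> start w_gt0 W_ge0 price_ge1 price_exp alloc; have [C0 remE startE] := start.
split=> //; first by rewrite C0.
- by rewrite remE w_gt0 lexx.
- by move=> r; rewrite startE price_ge1 lexx.
- by apply: bounded_growth_start => // r; exact: le_trans (price_ge1 r).
Qed.

Lemma phase_inv_initial w z : 0 < w -> phase_inv (initial w z).
Proof.
move=> w_gt0; apply: phase_inv_start => //=.
- by move=> r; rewrite mxE.
- by move=> r; rewrite !mxE mulr0 expR0.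
- exists 0; last by split=> // r.
  rewrite (_ : (fun D => _) = fun=> 0); first exact: (weighted_sum0 X_inst).
  by apply/funext => D; rewrite spent_start ?addr0.
Qed.

Section OracleStep.
Variables (c : config R m) (C : 'I_n).
Hypothesis customerE : customer c = C.
Hypothesis inv : phase_inv c.

Let c' := oracle_step f e c.

Lemma answer_in : X C (answer f c).
Proof.
by rewrite (answerE _ customerE); exact: (solver_in f_solver) (phase_price_ge0 inv).
Qed.

Lemma answer_ge0 : nonneg_vec (answer f c).
Proof. exact: (block_ge0 X_inst answer_in). Qed.

Lemma limited_max_gt0 : limited f c -> 0 < max_coord (answer f c).
Proof.
have /andP[rem_gt0 _] := phase_remaining inv.
by move=> /(lt_trans ltr01); rewrite pmulr_rgt0.
Qed.

Lemma step_size_gt0 : 0 < step_size f c.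
Proof.
rewrite /step_size; case: ifP => [/limited_max_gt0|_]; first by rewrite invr_gt0.
by case/andP: (phase_remaining inv).
Qed.

Lemma step_size_answer_ge0 r : 0 <= step_size f c * answer f c 0 r.
Proof. by rewrite mulr_ge0 ?answer_ge0 // ltW // step_size_gt0. Qed.

Lemma step_size_answer_le1 r : step_size f c * answer f c 0 r <= 1.
Proof.
have /andP[rem_gt0 _] := phase_remaining inv.
have answer_le : answer f c 0 r <= max_coord (answer f c).
  exact: (le_bigmax _ (fun r => answer f c 0 r)).
rewrite /step_size; case: ifP => [/limited_max_gt0 max_gt0|/negbT].
  by rewrite ler_pdivrMl // mulr1.
by rewrite -leNgt; apply: le_trans; rewrite ler_pM2l.
Qed.

Lemma limited_step_size : limited f c -> exists r, step_size f c * answer f c 0 r = 1.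
Proof.
move=> lim; have max_gt0 := limited_max_gt0 lim.
have [r answerE] := max_coord_attained max_gt0.
by exists r; rewrite /step_size lim answerE mulVf // gt_eqF.
Qed.

Lemma oracle_step_remaining : 0 < remaining c' <= weight c'.
Proof.
have /andP[rem_gt0 rem_le] := phase_remaining inv.
rewrite /c' /=; case: ifP => [lim|_]; last by rewrite lexx (lt_le_trans rem_gt0).
have xi_lt : step_size f c < remaining c.
  rewrite /step_size lim invf_plt ?posrE ?limited_max_gt0 //.
  by rewrite -[ltLHS]div1r ltr_pdivrMr // mulrC.
by have := step_size_gt0; lra.
Qed.

Lemma spent_oracle_step D :
  spent c' D = spent c D + (if D == C then step_size f c else 0).
Proof.
rewrite /spent /c' /= customerE -val_eqE /= /step_size.
by case: (limited f c); rewrite ?(ltnS, subrr, if_same); case: (ltngtP D C) => _; lra.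
Qed.

Lemma price_le_oracle_step r : price c 0 r <= price c' 0 r.
Proof.
rewrite mxE mulrDr mulr1 lerDl mulr_ge0 ?(phase_price_ge0 inv) //.
by rewrite mulr_ge0 ?step_size_answer_ge0 // ltW.
Qed.

Lemma sum_price_oracle_step S : \sum_(r in S) price c' 0 r
  = \sum_(r in S) price c 0 r + e * (step_size f c * block_value S C (price c)).
Proof.
rewrite /block_value !mulr_sumr -big_split /=; apply: eq_bigr => r _.
by rewrite mxE (answerE _ customerE); ring.
Qed.

Lemma price_sum_oracle_step_le : price_sum c' <= (1 + e) * price_sum c.
Proof.
rewrite mulr_sumr; apply: ler_sum => r _; rewrite mxE mulrC.
rewrite ler_wpM2r ?(phase_price_ge0 inv) // lerD2l -[leRHS]mulr1 ler_wpM2l //.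
  exact: ltW.
exact: step_size_answer_le1.
Qed.

Lemma sum_load_oracle_step :
  \sum_r load c 0 r + (limited f c)%:R <= \sum_r load c' 0 r.
Proof.
have -> : \sum_r load c' 0 r
    = \sum_r load c 0 r + \sum_r step_size f c * answer f c 0 r.
  by rewrite -big_split /=; apply: eq_bigr => r _; rewrite !mxE.
rewrite lerD2l; case: (boolP (limited f c)) => [/limited_step_size[r <-]|_].
  exact: (ler_sum_coord r step_size_answer_ge0).
by apply: sumr_ge0 => r _; exact: step_size_answer_ge0.
Qed.

Lemma exp_oracle_step : price_dominates_load c'.
Proof.
move=> r; rewrite !mxE mulrDr expRD; apply: ler_pM; rewrite ?expR_ge0 //.
  exact: phase_exp inv r.
by rewrite expR_le_1Dmul // step_size_answer_ge0 step_size_answer_le1.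
Qed.

Lemma bounded_growth_oracle_step : bounded_growth c'.
Proof.
move=> S; have [u u_bounds growth_le] := phase_bounded_growth inv S.
have price_ge0 := phase_price_ge0 inv.
pose dearer := block_value S C (u C) < block_value S C (price c).
exists (fun D => if (D == C) && dearer then price c else u D) => [D|].
  case: ifP => _; first by split=> // r; exact: price_le_oracle_step.
  have [u_ge0 u_le] := u_bounds D.
  by split=> // r; exact: le_trans (u_le r) (price_le_oracle_step r).
rewrite sum_price_oracle_step addrAC.
apply: (@le_trans _ _ (e * \sum_D spent c D * block_value S D (u D)
                       + e * (step_size f c * block_value S C (price c)))).
  by rewrite lerD2r.
rewrite -mulrDr ler_pM2l // [in leRHS](bigD1 C) //= [in leLHS](bigD1 C) //= eqxx /=.
rewrite [X in _ <= _ + X](eq_bigr (fun D => spent c D * block_value S D (u D)));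
  last by move=> D /negbTE DC; rewrite spent_oracle_step DC /= addr0.
rewrite spent_oracle_step eqxx addrAC lerD2r /dearer.
have /andP[spent_ge0 _] := spent_bounds C inv; have xi_gt0 := step_size_gt0.
by case: (ltP (block_value S C (u C))) => ?; nra.
Qed.

Lemma allocated_oracle_step : allocated c'.
Proof.
have [x alloc [x_le x_eq]] := phase_allocated inv.
exists (x + step_size f c *: answer f c).
  rewrite (_ : (fun D => _) = fun D => total_weight c + spent c D
      + (if D == C then step_size f c else 0)).
    apply: (weighted_sumD X_inst _ step_size_gt0 answer_in alloc).
    by rewrite addr_ge0 ?(phase_total inv) //; case/andP: (spent_bounds C inv).
  by apply/funext => D; rewrite spent_oracle_step addrA.
split=> [r|]; first by rewrite !mxE lerD2r.
by move=> /x_eq ->.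
Qed.

Lemma phase_inv_oracle_step : phase_inv c'.
Proof.
split.
- by rewrite /= customerE; case: ifP => _; rewrite ?ltn_ord // ltnW.
- exact: oracle_step_remaining.
- exact: phase_total inv.
- move=> r; have /andP[-> price_le] := phase_price inv r.
  exact: le_trans price_le (price_le_oracle_step r).
- exact: exp_oracle_step.
- exact: bounded_growth_oracle_step.
- exact: allocated_oracle_step.
Qed.

End OracleStep.

Section PhaseEnd.
Variable c : config R m.
Hypothesis inv : phase_inv c.

Lemma phase_inv_abort : phase_inv (abort_phase c).
Proof.
have w2_gt0 : 0 < weight c / 2 by rewrite divr_gt0 // (phase_weight_gt0 inv).
apply: phase_inv_start => //=; first exact: phase_total inv.
- by move=> r; exact: phase_price_ge1.
- exact: phase_exp inv.
have [x alloc [x_le _]] := phase_allocated inv.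
have [D|x' alloc' x'_le] := @weighted_sum_le _ _ _ _ X_inst _
    (fun D => total_weight c + spent (abort_phase c) D) _ _ alloc.
  by rewrite lerD2l spent_start //; case/andP: (spent_bounds D inv).
by exists x' => //; split=> // r; exact: le_trans (x'_le r) (x_le r).
Qed.

Lemma phase_inv_complete : (n <= customer c)%N -> phase_inv (complete_phase c).
Proof.
move=> n_le; have customerE : customer c = n.
  by apply/eqP; rewrite eqn_leq n_le (phase_customer inv).
have w_gt0 := phase_weight_gt0 inv.
apply: phase_inv_start => //=.
- by rewrite addr_ge0 ?(phase_total inv) // ltW.
- by move=> r; exact: phase_price_ge1.
- exact: phase_exp inv.
have [x alloc x_load] := phase_allocated inv; exists x => //.
rewrite (_ : (fun D => _) = fun D => total_weight c + spent c D) //.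
by apply/funext => D; rewrite spent_start // addr0 /= spent_end.
Qed.

Lemma price_growth S : exists2 u : 'I_n -> 'rV[R]_m,
    forall D, nonneg_vec (u D) /\ (forall r, u D 0 r <= price c 0 r) &
    \sum_(r in S) price c 0 r - \sum_(r in S) start_price c 0 r
      <= e * weight c * \sum_D block_value S D (u D).
Proof.
have [u u_bounds growth_le] := phase_bounded_growth inv S; exists u => //.
apply: le_trans growth_le _; rewrite -mulrA ler_pM2l // mulr_sumr.
apply: ler_sum => D _; have /andP[_ spent_le] := spent_bounds D inv.
rewrite ler_wpM2r // sumr_ge0 // => r _; have [u_ge0 _] := u_bounds D.
by rewrite mulr_ge0 // (solver_ge0 X_inst f_solver).
Qed.

Lemma price_growth_lwd S mu : 0 <= mu -> local_weak_duality f S mu ->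
  \sum_(r in S) price c 0 r - \sum_(r in S) start_price c 0 r
    <= e * weight c * mu * \sum_(r in S) price c 0 r.
Proof.
move=> mu_ge0 lwd; have [u u_bounds growth_le] := price_growth S.
apply: le_trans growth_le _; rewrite -[leRHS]mulrA ler_wpM2l //.
  by rewrite mulr_ge0 // ltW // phase_weight_gt0.
apply: le_trans (lwd u (fun D => (u_bounds D).1)) _; rewrite ler_wpM2l //.
apply: ler_sum => r _; apply/bigmax_leP; split=> [|D _]; last exact: (u_bounds D).2.
exact: phase_price_ge0.
Qed.

Lemma price_growth_opt :
  price_sum c - start_sum c <= e * weight c * sigma * \sum_D opt X D (price c).
Proof.
have [u u_bounds] := price_growth [set: 'I_m]%SET.
rewrite !sum_setT => growth_le; apply: le_trans growth_le _.
rewrite -[leRHS]mulrA ler_wpM2l //.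
  by rewrite mulr_ge0 // ltW // phase_weight_gt0.
rewrite mulr_sumr; apply: ler_sum => D _; rewrite /block_value sum_setT.
have [u_ge0 u_le] := u_bounds D; apply: le_trans (solver_le f_solver D u_ge0) _.
rewrite ler_wpM2l ?(le_trans ler01) //.
exact: (le_min_dotr (@block_neq0 _ _ _ _ X_inst D) (@block_ge0 _ _ _ _ X_inst D)).
Qed.

Lemma aborts_weight_gt : e <= 1 -> aborts e c ->
  1 < 2 * (sigma * lambda_star X * weight c).
Proof.
move=> e_le1; rewrite /aborts => abort_gt.
have price_gt0 : 0 < price_sum c.
  apply: le_lt_trans abort_gt; rewrite mulr_ge0 ?addr_ge0 ?(ltW e_gt0) //.
  by apply: sumr_ge0 => r _; have := phase_price inv r; lra.
have slam_ge0 : 0 <= sigma * lambda_star X.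
  by rewrite mulr_ge0 ?(lambda_ge0 X_inst) // (le_trans ler01).
have := price_growth_lwd slam_ge0 (weak_duality_setT X_inst f_solver sigma_ge1).
rewrite !sum_setT -/(price_sum c) -/(start_sum c) -[e * _ * _]mulrA.
rewrite [weight c * _]mulrC; set k := sigma * _ * _ => growth_le.
have k_ge0 : 0 <= k by rewrite mulr_ge0 // ltW // phase_weight_gt0.
have factor_lt : price_sum c * ((1 + e) * (1 - e * k)) < price_sum c * 1.
  rewrite mulr1; apply: le_lt_trans abort_gt.
  by rewrite mulrCA ler_pM2l ?addr_gt0 //; lra.
have := factor_lt; rewrite ltr_pM2l // => {}factor_lt.
have : 0 < e * (k * (1 + e) - 1) by lra.
by rewrite pmulr_rgt0 //; nra.
Qed.

Hypothesis m_gt0 : (0 < m)%N.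

Lemma lambda_total_le B :
  (forall r, load c 0 r <= B) -> lambda_star X * total_weight c <= B.
Proof.
move=> load_le; have B_ge0 : 0 <= B.
  exact: le_trans (phase_load_ge0 inv (Ordinal m_gt0)) (load_le _).
have [W0|W_neq0] := eqVneq (total_weight c) 0; first by rewrite W0 mulr0.
have W_gt0 : 0 < total_weight c by rewrite lt_neqAle eq_sym W_neq0 (phase_total inv).
have [x alloc [x_le _]] := phase_allocated inv.
have [D|x' alloc' x'_le] :=
    @weighted_sum_le _ _ _ _ X_inst _ (fun=> total_weight c) _ _ alloc.
  by rewrite lerDl; case/andP: (spent_bounds D inv).
rewrite -ler_pdivlMr //.
apply: (lambda_le_coord X_inst (weighted_sum_cst W_gt0 alloc')).
  by rewrite divr_ge0 // ltW.
move=> r; rewrite mxE mulrC ler_pM2r ?invr_gt0 //.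
exact: le_trans (x'_le r) (le_trans (x_le r) (load_le r)).
Qed.

Lemma load_le_of_price a r : price c 0 r <= m%:R * expR a ->
  load c 0 r <= (1 + e) / e * (ln m%:R + a).
Proof.
move=> price_le; have := le_trans (phase_exp inv r) price_le.
rewrite -[X in X * expR a]lnK ?posrE ?ltr0n // -expRD ler_expR.
by rewrite -[(1 + e) / e]invf_div ler_pdivlMl ?divr_gt0 ?addr_gt0.
Qed.

End PhaseEnd.
End Phase.

(** * A sequence of phases *)

Section Stage.
Variables (R : realType) (n m : nat).
Variables (X : 'I_n -> set 'rV[R]_m) (f : 'I_n -> 'rV[R]_m -> 'rV[R]_m).
Variable sigma : R.
Hypothesis X_inst : rs_instance X.
Hypothesis f_solver : block_solver sigma X f.
Hypothesis sigma_ge1 : 1 <= sigma.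
Hypothesis m_gt0 : (0 < m)%N.
Variables e Phi w0 : R.
Hypothesis e_gt0 : 0 < e.
Hypothesis e_le1 : e <= 1.
Implicit Types (c : config R m) (S : {set 'I_m}).

Local Notation lam := (lambda_star X).

Definition lwd_growth_bound c : Prop :=
  forall S mu, 0 <= mu -> local_weak_duality f S mu -> e * weight c * mu < 1 ->
    \sum_(r in S) start_price c 0 r
      <= m%:R * expR ((completed c)%:R
                      * (e * weight c * mu / (1 - e * weight c * mu))).

Definition certified_dual c : Prop := 0 < best_growth c ->
  simplex (dual_candidate c) /\
  1 - (best_growth c)^-1 <= e * weight c * sigma * \sum_D opt X D (dual_candidate c).

Record unaborted_inv c : Prop := UnabortedInv {
  unaborted_total : total_weight c = (completed c)%:R * weight c;
  unaborted_lwd : lwd_growth_bound c;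
  unaborted_growth :
    0 <= best_growth c /\ start_sum c <= m%:R * best_growth c ^+ completed c;
  unaborted_dual : certified_dual c }.

Record stage_inv c : Prop := StageInv {
  stage_phase : phase_inv X f e c;
  stage_customer : (customer c < n)%N;
  stage_weight : weight c * 2 ^+ aborted c = w0;
  stage_aborted : (0 < aborted c)%N -> 1 < 4 * (sigma * lam * weight c);
  stage_completed : (completed c)%:R <= Phi + 1;
  stage_total : (completed c)%:R * weight c <= total_weight c;
  stage_price_sum : price_sum c <= (1 + e) * start_sum c;
  stage_start_sum :
    start_sum c <= m%:R * expR (2 * e * (completed c + aborted c)%:R);
  stage_calls : (calls c)%:R
    <= (n * (completed c + aborted c) + customer c)%:R + \sum_r load c 0 r;
  stage_boundary : unfinished Phi c \/ at_phase_start c;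
  stage_unaborted : aborted c = 0%N -> unaborted_inv c }.

Lemma price_sum_gt0 c : phase_inv X f e c -> 0 < price_sum c.
Proof.
move=> inv; apply: lt_le_trans (ler_sum_coord (Ordinal m_gt0) (phase_price_ge0 inv)).
exact: lt_le_trans (phase_price_ge1 _ inv).
Qed.

Lemma start_sum_gt0 c : phase_inv X f e c -> 0 < start_sum c.
Proof.
move=> inv; have start_ge1 r : 1 <= start_price c 0 r by case/andP: (phase_price inv r).
have start_ge0 r : 0 <= start_price c 0 r := le_trans ler01 (start_ge1 r).
apply: lt_le_trans (ler_sum_coord (Ordinal m_gt0) start_ge0).
exact: lt_le_trans (start_ge1 _).
Qed.

Lemma sum_const_mx1 : \sum_(r < m) (const_mx 1 : 'rV[R]_m) 0 r = m%:R.
Proof.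
rewrite (eq_bigr (fun=> 1)) => [|r _]; last by rewrite mxE.
by rewrite sumr_const card_ord.
Qed.

Lemma unaborted_inv_initial z : unaborted_inv (initial w0 z).
Proof.
split; rewrite /= ?mul0r //.
- move=> S mu _ _ _; rewrite /= mul0r expR0 mulr1 -sum_const_mx1.
  rewrite [leRHS](bigID (mem S)) /= lerDl sumr_ge0 // => r _; by rewrite mxE.
- by rewrite /start_sum /= sum_const_mx1 expr0 mulr1.
- by rewrite /certified_dual /= ltxx.
Qed.

Lemma stage_inv_initial z :
  (0 < n)%N -> 0 < w0 -> 0 <= Phi -> stage_inv (initial w0 z).
Proof.
move=> n_gt0 w0_gt0 Phi_ge0; have inv := phase_inv_initial f X_inst e z w0_gt0.
split=> //=.
- by rewrite expr0 mulr1.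
- by rewrite addr_ge0.
- by rewrite mul0r.
- by rewrite /price_sum /start_sum /= sum_const_mx1 mulrDl mul1r lerDl mulr_ge0 // ltW.
- by rewrite /start_sum /= sum_const_mx1 mulr0 expR0 mulr1.
- by rewrite muln0 addn0 add0r sumr_ge0 // => r _; rewrite mxE.
- by right.
- by move=> _; exact: unaborted_inv_initial.
Qed.

Section StageStep.
Variable c : config R m.
Hypothesis inv : stage_inv c.
Hypothesis c_unfinished : unfinished Phi c.

Let c' := oracle_step f e c.

Lemma phase_inv_stage_step : phase_inv X f e c'.
Proof.
exact: (phase_inv_oracle_step (C := Ordinal (stage_customer inv)) X_inst f_solver e_gt0
  erefl (stage_phase inv)).
Qed.
Let inv' := phase_inv_stage_step.

Lemma completed_lt : (completed c)%:R < Phi.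
Proof.
rewrite -(ltr_pM2r (phase_weight_gt0 (stage_phase inv))).
exact: le_lt_trans (stage_total inv) c_unfinished.
Qed.

Lemma price_sum_stage_step_le :
  price_sum c' <= m%:R * expR (2 * e * (completed c + aborted c).+1%:R).
Proof.
have onee_ge0 : 0 <= 1 + e by rewrite addr_ge0 // ltW.
have := price_sum_oracle_step_le e_gt0 (stage_phase inv).
move/le_trans; apply; apply: (@le_trans _ _ ((1 + e) * ((1 + e) * start_sum c))).
  by rewrite ler_wpM2l // (stage_price_sum inv).
have start_ge0 := ltW (start_sum_gt0 (stage_phase inv)).
have -> : 2 * e * (completed c + aborted c).+1%:R
    = e + (e + 2 * e * (completed c + aborted c)%:R) by rewrite -natr1; ring.
rewrite !expRD [leRHS]mulrCA ler_pM ?mulr_ge0 ?expR_ge1Dx // [leRHS]mulrCA.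
by rewrite ler_pM ?expR_ge1Dx // (stage_start_sum inv).
Qed.

Lemma calls_stage_step : (calls c')%:R
  <= (n * (completed c + aborted c) + customer c')%:R + \sum_r load c' 0 r.
Proof.
have := sum_load_oracle_step (C := Ordinal (stage_customer inv)) X_inst f_solver
  erefl (stage_phase inv).
have := stage_calls inv; rewrite /= -natr1.
by case: (limited f c); rewrite /= ?addnS -?natr1 ?mulr0n; lra.
Qed.

Lemma lwd_growth_bound_complete :
  unaborted_inv c -> lwd_growth_bound (complete_phase c').
Proof.
move=> unab S mu mu_ge0 lwd; have := unaborted_lwd unab mu_ge0 lwd; rewrite /=.
have := price_growth_lwd X_inst f_solver e_gt0 inv' mu_ge0 lwd; rewrite /=.
set t := e * weight c * mu => growth_le start_le t_lt1.
have t_gt0 : 0 < 1 - t by rewrite subr_gt0.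
apply: (@le_trans _ _ ((\sum_(r in S) start_price c 0 r) / (1 - t))).
  by rewrite ler_pdivlMr //; move: growth_le; rewrite mulrBr mulr1; lra.
rewrite -natr1 mulrDl mul1r expRD mulrA ler_pM ?invr_ge0 ?(ltW t_gt0) ?start_le //.
  apply: sumr_ge0 => r _; have /andP[start_ge1 _] := phase_price (stage_phase inv) r.
  exact: le_trans start_ge1.
exact: inv1B_le_expR.
Qed.

Lemma start_sum_growth_complete : unaborted_inv c ->
  start_sum (complete_phase c')
    <= m%:R * best_growth (complete_phase c') ^+ (completed c).+1.
Proof.
move=> unab; have [growth_ge0 start_le] := unaborted_growth unab.
have growth_le : best_growth c <= best_growth (complete_phase c').
  by rewrite le_max lexx.
rewrite exprS mulrCA.
apply: (@le_trans _ _ (best_growth (complete_phase c') * start_sum c)).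
  rewrite -ler_pdivrMr ?(start_sum_gt0 (stage_phase inv)) //.
  by rewrite /= /phase_growth le_max lexx orbT.
rewrite ler_wpM2l ?(le_trans growth_ge0) //; apply: le_trans start_le _.
by rewrite ler_wpM2l // lerXn2r // nnegrE (le_trans growth_ge0).
Qed.

(* Divided by the final sum of the prices, [price_growth_opt] bounds the optima at
   the normalised prices from below. *)
Lemma certified_dual_complete : unaborted_inv c -> certified_dual (complete_phase c').
Proof.
move=> unab; have Y_gt0 := price_sum_gt0 inv'.
rewrite /certified_dual /= /Num.max.
case: (ltP (best_growth c) (phase_growth c')) => _ => [_|];
  last exact: (unaborted_dual unab).
split; first exact: (simplex_normalize (phase_price_ge0 inv')).
have := price_growth_opt X_inst f_solver sigma_ge1 e_gt0 inv'.
rewrite /= -/c' => growth_le.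
rewrite (eq_bigr (fun D => (price_sum c')^-1 * opt X D (price c'))); last first.
  move=> D _; apply: (min_dotZ (@block_neq0 _ _ _ _ X_inst D)
    (@block_ge0 _ _ _ _ X_inst D)); rewrite ?invr_gt0 //.
  exact: phase_price_ge0 inv'.
rewrite -mulr_sumr mulrCA -[leRHS]mulrC ler_pdivlMr // invf_div.
by rewrite mulrBl mul1r divfK ?gt_eqF.
Qed.

Lemma unaborted_inv_complete : unaborted_inv c -> unaborted_inv (complete_phase c').
Proof.
move=> unab; split.
- by rewrite /= (unaborted_total unab) -natr1 mulrDl mul1r.
- exact: lwd_growth_bound_complete.
- have [growth_ge0 _] := unaborted_growth unab.
  by split; [rewrite le_max growth_ge0|exact: start_sum_growth_complete].
- exact: certified_dual_complete.
Qed.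

Lemma stage_inv_abort : aborts e c' -> stage_inv (abort_phase c').
Proof.
move=> c'_aborts; have w_gt0 := phase_weight_gt0 inv'.
have w_gt := aborts_weight_gt X_inst f_solver sigma_ge1 e_gt0 inv' e_le1 c'_aborts.
split=> //=.
- exact: phase_inv_abort.
- exact: leq_ltn_trans (stage_customer inv).
- by rewrite exprS -(stage_weight inv) mulrA divfK.
- by move=> _; move: w_gt; rewrite /= mulrA; lra.
- exact: stage_completed inv.
- apply: le_trans (stage_total inv); rewrite ler_wpM2l //.
  by move: w_gt0; rewrite /=; lra.
- by rewrite mulrDl mul1r lerDl mulr_ge0 // ltW // price_sum_gt0.
- by rewrite addnS; exact: price_sum_stage_step_le.
- apply: le_trans calls_stage_step _; rewrite lerD2r ler_nat addn0 addnS mulnS.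
  by rewrite addnC leq_add2r; exact: phase_customer inv'.
- by right.
Qed.

Lemma stage_inv_continue : price_sum c' <= (1 + e) * start_sum c' ->
  (customer c' < n)%N -> stage_inv c'.
Proof.
move=> no_abort customer_lt; have := calls_stage_step; have := inv'.
move: inv; case=> ? ? ? ? ? ? ? ? ? ? unab; split=> //; first by left.
by move=> /unab[*]; split.
Qed.

Lemma stage_inv_complete : price_sum c' <= (1 + e) * start_sum c' ->
  (n <= customer c')%N -> stage_inv (complete_phase c').
Proof.
move=> no_abort n_le; split=> //=.
- exact: phase_inv_complete.
- exact: leq_ltn_trans (stage_customer inv).
- exact: stage_weight inv.
- exact: stage_aborted inv.
- by rewrite -natr1 lerD2r ltW // completed_lt.
- by rewrite -natr1 mulrDl mul1r lerD2r (stage_total inv).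
- by rewrite mulrDl mul1r lerDl mulr_ge0 // ltW // price_sum_gt0.
- exact: price_sum_stage_step_le.
- apply: le_trans calls_stage_step _; rewrite lerD2r ler_nat addn0 addSn mulnS.
  by rewrite addnC leq_add2r; exact: phase_customer inv'.
- by right.
- by move=> /(stage_unaborted inv); exact: unaborted_inv_complete.
Qed.

Lemma stage_inv_step : stage_inv (step f e c).
Proof.
rewrite /step -/c'; case: end_phaseP.
- exact: stage_inv_abort.
- exact: stage_inv_continue.
- exact: stage_inv_complete.
Qed.

End StageStep.

Section StageBounds.
Variable c : config R m.
Hypothesis inv : stage_inv c.

Lemma stage_load_le r : load c 0 r
  <= (1 + e) / e * (ln m%:R + e * (2 * (completed c + aborted c)%:R + 1)).
Proof.
have phase := stage_phase inv; apply: (load_le_of_price e_gt0 phase m_gt0).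
apply: le_trans (ler_sum_coord r (phase_price_ge0 phase)) _.
apply: le_trans (stage_price_sum inv) _.
rewrite mulrDr mulr1 mulrCA mulrA expRD [leRHS]mulrA [leRHS]mulrC.
rewrite ler_pM ?expR_ge1Dx ?(stage_start_sum inv) ?(ltW (start_sum_gt0 phase)) //.
by rewrite addr_ge0 // ltW.
Qed.

Lemma stage_calls_le : (calls c)%:R <= n%:R * ((completed c + aborted c)%:R + 1)
  + m%:R * ((1 + e) / e * (ln m%:R + e * (2 * (completed c + aborted c)%:R + 1))).
Proof.
apply: le_trans (stage_calls inv) _; apply: lerD.
  rewrite natr1 -natrM ler_nat mulnS addnC leq_add2r.
  exact: ltnW (stage_customer inv).
apply: le_trans (ler_sum _ (fun r _ => stage_load_le r)) _.
by rewrite sumr_const card_ord [leRHS]mulr_natl.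
Qed.

Lemma stage_weight_le : weight c <= w0.
Proof.
rewrite -(stage_weight inv) ler_peMr ?exprn_ege1 ?ler1n //.
exact: ltW (phase_weight_gt0 (stage_phase inv)).
Qed.

Lemma pow_aborted_lt : (0 < aborted c)%N -> 2 ^+ aborted c < 4 * (sigma * lam * w0).
Proof.
move=> /(stage_aborted inv); rewrite -(stage_weight inv).
rewrite -(ltr_pM2r (exprn_gt0 (aborted c) (ltr0n R 2))) mul1r.
by rewrite !mulrA.
Qed.

Lemma phases_le :
  (completed c + aborted c)%:R <= Phi + 1 + 4 * (sigma * lam * w0).
Proof.
rewrite natrD lerD ?(stage_completed inv) //.
have w_gt0 := phase_weight_gt0 (stage_phase inv).
have w0_gt0 : 0 < w0 := lt_le_trans w_gt0 stage_weight_le.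
have [->|/pow_aborted_lt/ltW] := posnP (aborted c); last first.
  by apply: le_trans; rewrite -natrX ler_nat ltnW // ltn_expl.
by rewrite !mulr_ge0 ?(lambda_ge0 X_inst) ?(ltW w0_gt0) // (le_trans ler01).
Qed.

End StageBounds.

Lemma stage_calls_bounded : exists B, forall c, stage_inv c -> (calls c <= B)%N.
Proof.
pose P := Phi + 1 + 4 * (sigma * lam * w0).
pose B := n%:R * (P + 1) + m%:R * ((1 + e) / e * (ln m%:R + e * (2 * P + 1))).
exists (Num.bound B) => c inv.
suff calls_le : (calls c)%:R <= B.
  rewrite -(ler_nat R) (le_trans calls_le) // ltW // archi_boundP //.
  exact: le_trans calls_le.
apply: le_trans (stage_calls_le inv) _; have phases := phases_le inv.
apply: lerD; first by rewrite ler_wpM2l // lerD2r.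
rewrite ler_wpM2l // ler_pM2l ?divr_gt0 ?addr_gt0 //.
by rewrite lerD2l ler_pM2l // lerD2r ler_pM2l.
Qed.

(** * Accuracy of a finished stage *)

Section Accuracy.
Variable c : config R m.
Hypothesis inv : stage_inv c.
Hypothesis finished : ~~ unfinished Phi c.
Hypothesis no_abort : aborted c = 0%N.
Hypothesis e_le_quarter : e <= 4^-1.
Hypothesis total_gt0 : 0 < total_weight c.
Hypothesis weight_le : sigma * lam * weight c <= 4^-1.
Hypothesis total_ge : ln m%:R <= e ^+ 2 * (lam * total_weight c).

Let phase := stage_phase inv.
Let unab := stage_unaborted inv no_abort.
Let w_gt0 : 0 < weight c := phase_weight_gt0 phase.
Let lam_ge0 : 0 <= lam := lambda_ge0 X_inst.
Let slam_ge0 : 0 <= sigma * lam.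
Proof. by rewrite mulr_ge0 // (le_trans ler01). Qed.

Lemma finished_phase_start : at_phase_start c.
Proof. by case: (stage_boundary inv) => // c_unf; move: finished; rewrite c_unf. Qed.

Lemma finished_minkowski_sum : minkowski_sum X ((total_weight c)^-1 *: load c).
Proof.
have [x alloc [_ /(_ no_abort) <-]] := phase_allocated phase.
apply: (weighted_sum_cst total_gt0).
rewrite (_ : (fun=> _) = fun D => total_weight c + spent c D) //.
by apply/funext => D; rewrite (spent_start _ finished_phase_start) addr0.
Qed.

Lemma load_ratio_le S mu r : 0 <= mu -> local_weak_duality f S mu -> r \in S ->
  e * weight c * mu < 1 ->
  load c 0 r / total_weight c
    <= (1 + e) * (ln m%:R / (e * total_weight c) + mu / (1 - e * weight c * mu)).
Proof.
move=> mu_ge0 lwd rS; set t := e * weight c * mu => t_lt1.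
have price_le : price c 0 r <= m%:R * expR ((completed c)%:R * (t / (1 - t))).
  apply: le_trans (unaborted_lwd unab mu_ge0 lwd t_lt1).
  have [_ _ ->] := finished_phase_start.
  rewrite (bigD1 r) //= lerDl sumr_ge0 // => i _; exact: phase_price_ge0 phase i.
rewrite ler_pdivrMr //; apply: le_trans (load_le_of_price e_gt0 phase m_gt0 price_le) _.
rewrite le_eqVlt; apply/orP; left; apply/eqP.
have := total_gt0; rewrite (unaborted_total unab) pmulr_lgt0 // => N_gt0.
by rewrite /t; field; rewrite !gt_eqF //= ?subr_gt0.
Qed.

Lemma load_ratio_accurate S mu r : 0 <= mu -> local_weak_duality f S mu -> r \in S ->
  weight c * mu <= 2^-1 ->
  load c 0 r / total_weight c <= (1 + e) * (e * lam + (1 + e) * mu).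
Proof.
move=> mu_ge0 lwd rS wmu_le.
have t_le : e * weight c * mu <= e * 2^-1 by rewrite -mulrA ler_pM2l.
have t_lt1 : e * weight c * mu < 1 by move: e_le1; lra.
apply: le_trans (load_ratio_le mu_ge0 lwd rS t_lt1) _.
rewrite ler_pM2l ?addr_gt0 //; apply: lerD.
  rewrite ler_pdivrMr ?mulr_gt0 //; apply: le_trans total_ge _.
  by rewrite le_eqVlt; apply/orP; left; apply/eqP; ring.
rewrite ler_pdivrMr ?subr_gt0 // mulrAC ler_peMl //.
by move: e_gt0 e_le1; nra.
Qed.

Lemma finished_norm_le : `|(total_weight c)^-1 *: load c| <= (1 + 4 * e) * sigma * lam.
Proof.
have bound_ge0 : 0 <= (1 + 4 * e) * sigma * lam.
  by rewrite -mulrA mulr_ge0 // addr_ge0 // mulr_ge0 // ltW.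
apply: norm_le_coord => // i r; rewrite (ord1 i).
rewrite ger0_norm ?(minkowski_sum_ge0 X_inst finished_minkowski_sum) // mxE mulrC.
have wmu_le : weight c * (sigma * lam) <= 2^-1 by rewrite mulrC; move: weight_le; lra.
apply: le_trans (load_ratio_accurate slam_ge0
  (weak_duality_setT X_inst f_solver sigma_ge1) (finset.in_setT r) wmu_le) _.
have lam_le : e * lam <= e * (sigma * lam) by rewrite ler_pM2l // ler_peMl.
apply: (@le_trans _ _ ((1 + e) * (1 + 2 * e) * (sigma * lam))).
  by rewrite -mulrA ler_pM2l ?addr_gt0 //; lra.
by rewrite -[leRHS]mulrA ler_wpM2r //; move: e_gt0 e_le_quarter; nra.
Qed.

Lemma finished_lwd S mu : 0 <= mu -> local_weak_duality f S mu ->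
  \big[Num.max/0]_(r in S) ((total_weight c)^-1 *: load c) 0 r
    <= mu + 4 * e * Num.max lam mu.
Proof.
move=> mu_ge0 lwd; set M := Num.max lam mu.
have [lam_le mu_le] : lam <= M /\ mu <= M by rewrite /M !le_max !lexx orbT.
have eM_ge0 : 0 <= e * M by rewrite mulr_ge0 ?(ltW e_gt0) // (le_trans mu_ge0).
apply/bigmax_leP; split=> [|r rS]; first by rewrite -mulrA; lra.
have [mu_small|mu_large] := leP mu (2 * (sigma * lam)); last first.
  apply: le_trans (ler_norm _) _; apply: le_trans (coord_le_norm _ 0 r) _.
  apply: le_trans finished_norm_le _; rewrite -mulrA.
  apply: (@le_trans _ _ (2 * (sigma * lam))); last by rewrite -mulrA; lra.
  by rewrite ler_wpM2r //; move: e_le_quarter; lra.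
rewrite mxE mulrC.
have wmu_le : weight c * mu <= 2^-1.
  apply: (@le_trans _ _ (weight c * (2 * (sigma * lam)))); first by rewrite ler_pM2l.
  by rewrite mulrC -mulrA; move: weight_le; lra.
apply: le_trans (load_ratio_accurate mu_ge0 lwd rS wmu_le) _.
apply: (@le_trans _ _ (mu + (3 + 2 * e) * (e * M))).
  have elam_le : e * (1 + e) * lam <= e * (1 + e) * M.
    by rewrite ler_wpM2l // mulr_ge0 ?addr_ge0 // ltW.
  have emu_le : e * (2 + e) * mu <= e * (2 + e) * M.
    by rewrite ler_wpM2l // mulr_ge0 ?addr_ge0 // ltW.
  lra.
by rewrite lerD2l -[leRHS]mulrA ler_wpM2r //; move: e_le_quarter; lra.
Qed.

(* Some phase must have multiplied the sum of the prices by nearly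
   [1 + e * lam * w], because the loads are at least [lam * total_weight]. *)
Lemma finished_ln_growth_ge :
  0 < best_growth c /\ lam * weight c * (e * (1 - 2 * e)) <= ln (best_growth c).
Proof.
have := total_gt0; rewrite (unaborted_total unab) pmulr_lgt0 // => N_gt0.
have [growth_ge0 start_le] := unaborted_growth unab.
have growth_gt0 : 0 < best_growth c.
  rewrite lt_neqAle growth_ge0 andbT; apply/eqP => growth0; move: start_le.
  rewrite -growth0 expr0n -(eqr_nat R) gt_eqF //= mulr0.
  by rewrite leNgt (start_sum_gt0 phase).
have price_le r : price c 0 r <= m%:R * expR ((completed c)%:R * ln (best_growth c)).
  rewrite [_ * ln _]mulr_natl -lnXn // lnK ?posrE ?exprn_gt0 //.
  apply: le_trans start_le; have [_ _ startE] := finished_phase_start.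
  by rewrite /start_sum startE; exact: ler_sum_coord (phase_price_ge0 phase).
have := lambda_total_le X_inst phase m_gt0
  (fun r => load_le_of_price e_gt0 phase m_gt0 (price_le r)).
rewrite -[(1 + e) / e]invf_div ler_pdivlMl ?divr_gt0 ?addr_gt0 // => loads_ge.
split=> //; rewrite -(ler_pM2l N_gt0).
apply: (@le_trans _ _ (lam * total_weight c * (e / (1 + e) - e ^+ 2))); last first.
  by move: loads_ge total_ge; lra.
have -> : (completed c)%:R * (lam * weight c * (e * (1 - 2 * e)))
    = lam * total_weight c * (e * (1 - 2 * e)) by rewrite (unaborted_total unab); ring.
rewrite ler_wpM2l ?(mulr_ge0 _ (ltW total_gt0)) //.
have : e * (1 - e) <= e / (1 + e).
  rewrite ler_pdivlMr ?addr_gt0 // -mulrA ler_piMr ?(ltW e_gt0) //.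
  by move: e_gt0; nra.
lra.
Qed.

Lemma finished_dual : simplex (dual_candidate c) /\
  (1 - 4 * e) * (lam / sigma) <= min_dot (minkowski_sum X) (dual_candidate c).
Proof.
have [growth_gt0] := finished_ln_growth_ge.
have [z_simplex cert] := unaborted_dual unab growth_gt0.
have sigma_gt0 : 0 < sigma := lt_le_trans ltr01 sigma_ge1.
set v := lam * weight c; set h := v * (e * (1 - 2 * e)) => h_le; split=> //.
have v_ge0 : 0 <= v by rewrite mulr_ge0 // ltW.
have v_le1 : v <= 1.
  have : v <= sigma * v by rewrite ler_peMl.
  by move: weight_le; rewrite -mulrA -/v; lra.
have h_ge0 : 0 <= h.
  by rewrite mulr_ge0 // mulr_ge0 ?(ltW e_gt0) //; move: e_le_quarter; lra.
have h_le_e : h <= e.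
  rewrite /h mulrCA ler_piMr ?(ltW e_gt0) // mulr_ile1 //.
    by move: e_le_quarter; lra.
  by move: e_gt0; lra.
have inv_growth_le : (best_growth c)^-1 <= 1 - h * (1 - e).
  apply: (@le_trans _ _ (1 + h)^-1).
    rewrite lef_pV2 ?posrE // ?ltr_wpDr //; apply: le_trans (expR_ge1Dx h) _.
    by rewrite -[leRHS]lnK ?posrE // ler_expR.
  rewrite -div1r ler_pdivrMr ?ltr_wpDr //.
  have : 0 <= h * (e - h + e * h).
    by rewrite mulr_ge0 // addr_ge0 ?subr_ge0 // mulr_ge0 // ltW.
  lra.
have z_ge0 : nonneg_vec (dual_candidate c).
  by move=> r; have [/(_ r)/andP[]] := z_simplex.
apply: le_trans (sum_opt_le_min_dot X_inst z_ge0).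
have scale_gt0 : 0 < e * weight c * sigma by rewrite !mulr_gt0.
rewrite -(ler_pM2l scale_gt0); apply: le_trans cert.
apply: (@le_trans _ _ (h * (1 - e))); last by lra.
rewrite (_ : e * weight c * sigma * _ = v * e * (1 - 4 * e)).
  rewrite /h -!mulrA ler_wpM2l // ler_pM2l //; move: e_gt0; nra.
by rewrite /v; field; rewrite gt_eqF.
Qed.

End Accuracy.
End Stage.

(** * Total correctness of programs *)

Declare Scope rexpr_scope.
Delimit Scope rexpr_scope with RX.
Bind Scope rexpr_scope with rexpr.
Arguments BRLt (_ _)%_rexpr_scope.
Local Infix "+" := RAdd : rexpr_scope.
Local Infix "-" := RSub : rexpr_scope.
Local Infix "*" := RMul : rexpr_scope.
Local Infix "/" := RDiv : rexpr_scope.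
Local Notation "c1 ;; c2" := (Seq c1 c2) (at level 90, right associativity).

(* The first group numbers registers, the second one arrays. *)
Local Notation NumCustomers := 0%N (only parsing).
Local Notation NumResources := 1%N (only parsing).
Local Notation Customer := 2%N (only parsing).
Local Notation Index := 3%N (only parsing).
Local Notation Power := 4%N (only parsing).

Local Notation Scalars := 0%N (only parsing).
Local Notation Loads := 1%N (only parsing).
Local Notation Dual := 2%N (only parsing).
Local Notation Prices := 3%N (only parsing).
Local Notation Answer := 4%N (only parsing).

Definition cell (k : nat) : rexpr := RGet Scalars (ICst k).
Definition set_cell (k : nat) (x : rexpr) : cmd := RSet Scalars (ICst k) x.
Definition entry (a : nat) : rexpr := RGet a (IVar Index).

Definition for_resources (c : cmd) : cmd :=
  ISet Index (ICst 0) ;;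
  While (BILt (IVar Index) (IVar NumResources))
    (c ;; ISet Index (IAdd (IVar Index) (ICst 1))).

Definition map_entries (a : nat) (x : rexpr) : cmd :=
  for_resources (RSet a (IVar Index) x).

Definition sum_entries (a k : nat) : cmd :=
  set_cell k (RCst 0) ;;
  for_resources (set_cell k (cell k + entry a)).

Definition max_entries (a k : nat) : cmd :=
  set_cell k (RCst 0) ;;
  for_resources (If (BRLt (cell k) (entry a)) (set_cell k (entry a)) Skip).

(* Entries of the array a are only read at the current index. *)
Fixpoint pointwise (a : nat) (x : rexpr) : bool :=
  match x with
  | RCst _ => true
  | RGet b (ICst _) => b != a
  | RGet b (IVar v) => (v == Index) || (b != a)
  | RGet _ _ => false
  | RAdd x1 x2 | RSub x1 x2 | RMul x1 x2 | RDiv x1 x2 =>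
      pointwise a x1 && pointwise a x2
  end.

Lemma bigmax_ord_recr d (T : orderType d) k (F : 'I_k.+1 -> T) (x0 : T) :
  \big[Order.max/x0]_(i < k.+1) F i
    = Order.max (\big[Order.max/x0]_(i < k) F (widen_ord (leqnSn k) i)) (F ord_max).
Proof.
apply/eqP; rewrite eq_le ge_max; apply/and3P; split.
- apply/bigmax_leP; split=> [|i _]; first by rewrite le_max bigmax_ge_id.
  case: (unliftP ord_max i) => [j ->|->]; rewrite le_max ?lexx ?orbT //.
  apply/orP; left; rewrite (_ : lift _ _ = widen_ord (leqnSn k) j).
    exact: (le_bigmax _ (fun i => F (widen_ord (leqnSn k) i))).
  by apply: val_inj; rewrite /= /bump leqNgt ltn_ord.
- apply/bigmax_leP; split=> [|i _]; first exact: bigmax_ge_id.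
  exact: (le_bigmax _ F).
- exact: (le_bigmax _ F).
Qed.

Section States.
Variables (R : realType) (m : nat).
Implicit Types s : state R.

Lemma state_eq s s' : ivar s =1 ivar s' -> rmem s =2 rmem s' -> s = s'.
Proof.
case: s s' => [iv rm] [iv' rm'] /= /funext-> rmE; congr State.
by apply/funext => a; apply/funext => j.
Qed.

Lemma set_ivarK s v k l : set_ivar (set_ivar s v k) v l = set_ivar s v l.
Proof. by apply: state_eq => //= w; case: eqP. Qed.

Lemma set_ivar_id s v : set_ivar s v (ivar s v) = s.
Proof. by apply: state_eq => //= w; case: eqP => // ->. Qed.

Lemma read_write_vec s a (x : 'rV[R]_m) : read_vec m (write_vec s a x) a = x.
Proof. by apply/rowP => r; rewrite mxE /= eqxx valK. Qed.

Lemma read_set_ivar s v k a : read_vec m (set_ivar s v k) a = read_vec m s a.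
Proof. by []. Qed.

Lemma read_set_rmem s a b i x :
  a != b -> read_vec m (set_rmem s b i x) a = read_vec m s a.
Proof. by move=> /negbTE ab; apply/rowP => r; rewrite !mxE /= ab. Qed.

Lemma read_write_vec_neq s a b (x : 'rV[R]_m) :
  a != b -> read_vec m (write_vec s b x) a = read_vec m s a.
Proof. by move=> /negbTE ab; apply/rowP => r; rewrite !mxE /= ab. Qed.

Definition read_vecE :=
  (read_set_ivar, read_set_rmem, read_write_vec, read_write_vec_neq).

Lemma reval_pointwise s a x (u : 'rV[R]_m) (r : 'I_m) :
  pointwise a x -> u 0 r = rmem s a r ->
  reval (set_ivar (write_vec s a u) Index r) x = reval (set_ivar s Index r) x.
Proof.
move=> + uE; elim: x => //= [b [k|v|//|//]|x1 IH1 x2 IH2|x1 IH1 x2 IH2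
  |x1 IH1 x2 IH2|x1 IH1 x2 IH2] /=; try by move=> /andP[/IH1-> /IH2->].
  by move=> /negbTE ->.
have [_ _|_ /negbTE->//] := eqVneq v Index; rewrite valK uE.
by case: eqP => [->|].
Qed.

End States.

Section Runs.
Variables (R : realType) (n m : nat) (f : 'I_n -> 'rV[R]_m -> 'rV[R]_m).
Implicit Types (s : state R) (Q : state R -> Prop) (c : cmd) (t q : nat).

Definition runs c s t q Q : Prop :=
  exists s' t' q', [/\ exec f c s s' t' q', (t' <= t)%N, (q' <= q)%N & Q s'].

Lemma runs_le t q t' q' c s Q : (t <= t')%N -> (q <= q')%N ->
  runs c s t q Q -> runs c s t' q' Q.
Proof.
move=> tt' qq' [s' [u [p [run ut pq Qs']]]]; exists s', u, p; split=> //.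
  exact: leq_trans tt'.
exact: leq_trans qq'.
Qed.

Lemma runs_impl Q Q' c s t q : (forall s', Q s' -> Q' s') ->
  runs c s t q Q -> runs c s t q Q'.
Proof. by move=> QQ' [s' [u [p [? ? ? /QQ' ?]]]]; exists s', u, p. Qed.

Lemma runs_skip s Q : Q s -> runs Skip s 1 0 Q.
Proof. by exists s, 1%N, 0%N; split=> //; exact: ExecSkip. Qed.

Lemma runs_iset s v i Q : Q (set_ivar s v (ieval s i)) -> runs (ISet v i) s 1 0 Q.
Proof. by exists (set_ivar s v (ieval s i)), 1%N, 0%N; split=> //; exact: ExecISet. Qed.

Lemma runs_rset s a i x Q :
  Q (set_rmem s a (ieval s i) (reval s x)) -> runs (RSet a i x) s 1 0 Q.
Proof. by eexists; exists 1%N, 0%N; split; first exact: ExecRSet. Qed.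

Lemma runs_seq c1 c2 s t1 t2 q1 q2 Q :
  runs c1 s t1 q1 (fun s1 => runs c2 s1 t2 q2 Q) ->
  runs (c1 ;; c2) s (t1 + t2) (q1 + q2) Q.
Proof.
move=> [s1 [u1 [p1 [run1 ut1 pq1 [s2 [u2 [p2 [run2 ut2 pq2 Qs2]]]]]]]].
exists s2, (u1 + u2)%N, (p1 + p2)%N; split; rewrite ?leq_add //.
exact: ExecSeq run1 run2.
Qed.

Lemma runs_bind (J : Type) (t2 q2 : J -> nat) (Q2 : J -> state R -> Prop)
    c1 c2 s t1 q1 Q1 :
  runs c1 s t1 q1 Q1 ->
  (forall s1, Q1 s1 -> exists j, runs c2 s1 (t2 j) (q2 j) (Q2 j)) ->
  exists j, runs (c1 ;; c2) s (t1 + t2 j) (q1 + q2 j) (Q2 j).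
Proof.
move=> [s1 [u [p [run1 ut pq /[swap] run2 /run2[j run]]]]]; exists j.
by apply: runs_seq; exists s1, u, p.
Qed.

Lemma runs_call (C : 'I_n) s i p a Q :
  ieval s i = C -> nonneg_vec (read_vec m s p) ->
  Q (write_vec s a (f C (read_vec m s p))) -> runs (Call i p a) s 1 1 Q.
Proof.
by move=> iC p_ge0 Qs; eexists; exists 1%N, 1%N; split; first exact: ExecCall iC p_ge0.
Qed.

Lemma runs_if b c1 c2 s t1 t2 q1 q2 Q :
  (beval s b -> runs c1 s t1 q1 Q) -> (~~ beval s b -> runs c2 s t2 q2 Q) ->
  runs (If b c1 c2) s (maxn t1 t2).+1 (maxn q1 q2) Q.
Proof.
move=> run1 run2; case: (boolP (beval s b)) => bs.
  have [s' [u [p [run ut pq Qs']]]] := run1 bs; exists s', u.+1, p.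
  by split; rewrite ?ltnS ?leq_max ?ut ?pq //; exact: ExecIfTrue.
have [s' [u [p [run ut pq Qs']]]] := run2 bs; exists s', u.+1, p.
by split; rewrite ?ltnS ?leq_max ?ut ?pq ?orbT //; exact: ExecIfFalse.
Qed.

Lemma runs_while b c k t B (I : nat -> state R -> Prop) s :
  (forall j s1, I j s1 -> beval s1 b -> runs c s1 t k (I j.+1)) ->
  (forall j s1, I j s1 -> (j <= B)%N) -> I 0%N s ->
  exists j, runs (While b c) s (t.+1 * j + 1) (k * j)
    (fun s' => I j s' /\ ~~ beval s' b).
Proof.
move=> body bounded I0.
suff loop d i s1 : I i s1 -> (B - i <= d)%N -> exists j,
    runs (While b c) s1 (t.+1 * j + 1) (k * j)
      (fun s' => I (i + j)%N s' /\ ~~ beval s' b).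
  by have [j] := loop B 0%N s I0 (leq_subr _ _); exists j.
elim: d i s1 => [|d IH] i s1 Is1 di; have [bs|bs] := boolP (beval s1 b).
- have [s2 [_ [_ [_ _ _ /bounded]]]] := body _ _ Is1 bs; lia.
- exists 0%N, s1, 1%N, 0%N; rewrite ?muln0 ?addn0; split=> //; exact: ExecWhileFalse.
- have [s2 [u [p [run ut pk Is2]]]] := body _ _ Is1 bs.
  have [|j [s3 [v [r [run' vt rk [Is3 nbs]]]]]] := IH _ _ Is2; first by lia.
  exists j.+1, s3, (u + v).+1, (p + r)%N; split; rewrite ?addnS //; try by nia.
  exact: ExecWhileTrue run run'.
- exists 0%N, s1, 1%N, 0%N; rewrite ?muln0 ?addn0; split=> //; exact: ExecWhileFalse.
Qed.

Lemma runs_for_resources c t (T : nat -> state R) s Q :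
  (forall r, ivar (T r) NumResources = m) -> T 0%N = s ->
  (forall r : 'I_m, runs c (set_ivar (T r) Index r) t 0
                      (eq (set_ivar (T r.+1) Index r))) ->
  Q (set_ivar (T m) Index m) ->
  runs (for_resources c) s ((t + 2) * m + 2) 0 Q.
Proof.
move=> Tm T0 body QT; pose I j s1 := (j <= m)%N /\ s1 = set_ivar (T j) Index j.
have I0 : I 0%N (set_ivar s Index 0) by rewrite /I T0.
have loop_body j s1 : I j s1 -> beval s1 (BILt (IVar Index) (IVar NumResources)) ->
    runs (c ;; ISet Index (IAdd (IVar Index) (ICst 1))) s1 (t + 1) 0 (I j.+1).
  move=> [jm ->] /=; rewrite Tm => j_lt; apply: (runs_seq (q1 := 0) (q2 := 0)).
  apply: runs_impl (body (Ordinal j_lt)) => _ <-; apply: runs_iset.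
  by split=> //=; rewrite addn1 set_ivarK.
have [j] := runs_while loop_body (fun j s1 (Ij : I j s1) => Ij.1) I0.
move=> [s' [u [p [run ut pk [[jm s'E] nbs]]]]].
have jE : j = m by move: nbs; rewrite s'E /= Tm; lia.
apply: (@runs_le (1 + ((t + 1).+1 * j + 1)) (0 + 0 * j)); [by lia|by []|].
by apply: runs_seq; apply: runs_iset; exists s', u, p; split=> //; rewrite s'E jE.
Qed.

Lemma runs_map_entries (v : 'rV[R]_m) a x s Q :
  ivar s NumResources = m -> pointwise a x ->
  (forall r : 'I_m, reval (set_ivar s Index r) x = v 0 r) ->
  Q (set_ivar (write_vec s a v) Index m) -> runs (map_entries a x) s (3 * m + 2) 0 Q.
Proof.
move=> sm pw xE QT.
pose prefix k : 'rV[R]_m := \row_r (if (r < k)%N then v 0 r else rmem s a r).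
apply: (@runs_for_resources _ 1 (fun k => write_vec s a (prefix k))) => //.
- apply: state_eq => // b j /=; case: eqP => // ->.
  by case: insubP => // r _ <-; rewrite mxE.
- move=> r; apply: runs_rset; rewrite (reval_pointwise pw) ?mxE ?ltnn // xE.
  apply: state_eq => // b j; rewrite /=.
  have [->|//] := eqVneq b a; case: insubP => /= [r' _ <-|]; rewrite ?mxE.
    by rewrite ltnS leq_eqVlt; case: eqP => // /val_inj ->.
  by case: eqP => // ->; rewrite ltn_ord.
- rewrite (_ : prefix m = v) //.
  by apply/rowP => r; rewrite mxE ltn_ord.
Qed.

Lemma runs_sum_entries a k s Q : ivar s NumResources = m -> a != Scalars ->
  Q (set_ivar (set_rmem s Scalars k (\sum_r read_vec m s a 0 r)) Index m) ->
  runs (sum_entries a k) s (3 * m + 3) 0 Q.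
Proof.
move=> sm a_neq0 QT; apply: (@runs_le (1 + (3 * m + 2)) (0 + 0)); [lia|by []|].
apply: runs_seq; apply: runs_rset.
apply: (@runs_for_resources _ 1
  (fun r => set_rmem s Scalars k (\sum_(i < r) rmem s a i))) => //.
- by rewrite big_ord0.
- move=> r; apply: runs_rset; rewrite /= !eqxx (negbTE a_neq0) /= big_ord_recr /=.
  by apply: state_eq => //= b j; case: (_ && _).
- rewrite (eq_bigr (fun r => read_vec m s a 0 r)) // => r _; by rewrite mxE.
Qed.

Lemma runs_max_entries a k s Q : ivar s NumResources = m -> a != Scalars ->
  Q (set_ivar (set_rmem s Scalars k (max_coord (read_vec m s a))) Index m) ->
  runs (max_entries a k) s (4 * m + 3) 0 Q.
Proof.
move=> sm a_neq0 QT; apply: (@runs_le (1 + (4 * m + 2)) (0 + 0)); [lia|by []|].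
apply: runs_seq; apply: runs_rset.
apply: (@runs_for_resources _ 2
  (fun r => set_rmem s Scalars k (\big[Num.max/0]_(i < r) rmem s a i))) => //.
- by rewrite big_ord0.
- move=> r; apply: (@runs_if _ _ _ _ 1 1 0 0);
    rewrite /= !eqxx (negbTE a_neq0) /= bigmax_ord_recr /Num.max /= => lt_max.
    apply: runs_rset; rewrite /= (negbTE a_neq0) lt_max.
    by apply: state_eq => //= b j; case: (_ && _).
  by apply: runs_skip; rewrite (negbTE lt_max).
- rewrite (_ : \big[_/_]_(i < m) _ = max_coord (read_vec m s a)) //.
  by apply: eq_bigr => r _; rewrite mxE.
Qed.

End Runs.

(** * The program *)

(* Indices in the array [Scalars]. *)
Local Notation Delta := 0%N (only parsing).
Local Notation Rate := 1%N (only parsing).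
Local Notation Target := 2%N (only parsing).
Local Notation Weight := 3%N (only parsing).
Local Notation Total := 4%N (only parsing).
Local Notation Remaining := 5%N (only parsing).
Local Notation PriceSum := 6%N (only parsing).
Local Notation StartSum := 7%N (only parsing).
Local Notation Growth := 8%N (only parsing).
Local Notation MaxAnswer := 9%N (only parsing).
Local Notation StepSize := 10%N (only parsing).
Local Notation Log := 11%N (only parsing).
Local Notation FirstLoad := 12%N (only parsing).

Definition step_size_cmd : cmd :=
  If (BRLt (RCst 1) (cell Remaining * cell MaxAnswer))
    (set_cell StepSize (RCst 1 / cell MaxAnswer) ;;
     set_cell Remaining (cell Remaining - cell StepSize))
    (set_cell StepSize (cell Remaining) ;;
     set_cell Remaining (cell Weight) ;;
     ISet Customer (IAdd (IVar Customer) (ICst 1))).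

Definition oracle_step_cmd : cmd :=
  Call (IVar Customer) Prices Answer ;;
  max_entries Answer MaxAnswer ;;
  step_size_cmd ;;
  map_entries Loads (entry Loads + cell StepSize * entry Answer) ;;
  map_entries Prices
    (entry Prices * (RCst 1 + cell Rate * (cell StepSize * entry Answer))) ;;
  sum_entries Prices PriceSum.

Definition start_phase_cmd : cmd :=
  ISet Customer (ICst 0) ;;
  set_cell Remaining (cell Weight) ;;
  set_cell StartSum (cell PriceSum).

Definition abort_phase_cmd : cmd :=
  set_cell Weight (cell Weight / RCst 2) ;; start_phase_cmd.

Definition record_dual_cmd : cmd :=
  If (BRLt (cell Growth) (cell PriceSum / cell StartSum))
    (set_cell Growth (cell PriceSum / cell StartSum) ;;
     map_entries Dual (entry Prices / cell PriceSum))
    Skip.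

Definition complete_phase_cmd : cmd :=
  record_dual_cmd ;;
  set_cell Total (cell Total + cell Weight) ;;
  start_phase_cmd.

Definition end_phase_cmd : cmd :=
  If (BRLt ((RCst 1 + cell Rate) * cell StartSum) (cell PriceSum))
    abort_phase_cmd
    (If (BILt (IVar Customer) (IVar NumCustomers)) Skip complete_phase_cmd).

Definition init_stage_cmd : cmd :=
  map_entries Prices (RCst 1) ;;
  map_entries Loads (RCst 0) ;;
  sum_entries Prices PriceSum ;;
  set_cell Total (RCst 0) ;;
  set_cell Growth (RCst 0) ;;
  start_phase_cmd.

Definition stage_cmd : cmd :=
  init_stage_cmd ;;
  While (BRLt (cell Total) (cell Target * cell Weight))
    (oracle_step_cmd ;; end_phase_cmd).

Section Simulation.
Variables (R : realType) (n m : nat) (f : 'I_n -> 'rV[R]_m -> 'rV[R]_m).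
Variables delta l e Phi : R.
Implicit Types (c : config R m) (s : state R).

Record stores c s : Prop := Stores {
  stored_n : ivar s NumCustomers = n;
  stored_m : ivar s NumResources = m;
  stored_customer : ivar s Customer = customer c;
  stored_delta : rmem s Scalars Delta = delta;
  stored_log : rmem s Scalars Log = l;
  stored_rate : rmem s Scalars Rate = e;
  stored_target : rmem s Scalars Target = Phi;
  stored_weight : rmem s Scalars Weight = weight c;
  stored_total : rmem s Scalars Total = total_weight c;
  stored_remaining : rmem s Scalars Remaining = remaining c;
  stored_start : rmem s Scalars StartSum = start_sum c;
  stored_growth : rmem s Scalars Growth = best_growth c;
  stored_price : read_vec m s Prices = price c;
  stored_load : read_vec m s Loads = load c;
  stored_dual : read_vec m s Dual = dual_candidate c }.

Lemma runs_step_size c s Q :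
  ivar s Customer = customer c -> rmem s Scalars Remaining = remaining c ->
  rmem s Scalars Weight = weight c ->
  rmem s Scalars MaxAnswer = max_coord (answer f c) ->
  Q (set_ivar (set_rmem (set_rmem s Scalars StepSize (step_size f c))
       Scalars Remaining (remaining (oracle_step f e c)))
     Customer (customer (oracle_step f e c))) ->
  runs f step_size_cmd s 4 0 Q.
Proof.
move=> customerE remE weightE maxE; rewrite /= /step_size => Qs.
apply: (runs_if (t1 := 2) (t2 := 3) (q1 := 0) (q2 := 0)) => /=;
  rewrite remE maxE => lim.
  rewrite /limited lim in Qs; apply: (runs_seq (t1 := 1) (t2 := 1) (q1 := 0) (q2 := 0)).
  do 2!apply: runs_rset; rewrite -[X in Q X](set_ivar_id _ Customer).
  by rewrite /= remE maxE div1r customerE.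
rewrite /limited (negbTE lim) in Qs.
apply: (runs_seq (t1 := 1) (t2 := 2) (q1 := 0) (q2 := 0)).
apply: runs_rset; apply: (runs_seq (t1 := 1) (t2 := 1) (q1 := 0) (q2 := 0)).
by apply: runs_rset; apply: runs_iset; rewrite /= remE weightE customerE addn1.
Qed.

Lemma runs_oracle_step c s (C : 'I_n) :
  stores c s -> customer c = C -> nonneg_vec (price c) ->
  runs f oracle_step_cmd s (13 * m + 15) 1 (fun s' =>
    stores (oracle_step f e c) s' /\
    rmem s' Scalars PriceSum = price_sum (oracle_step f e c)).
Proof.
set c' := oracle_step f e c; move=> st customerE price_ge0; apply: runs_le; last first.
  apply: runs_seq; apply: (runs_call (C := C)).
  - by rewrite /= (stored_customer st).
  - by rewrite (stored_price st).
  rewrite (stored_price st) -(answerE f customerE).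
  apply: runs_seq; apply: runs_max_entries => //; first exact: stored_m st.
  rewrite read_write_vec.
  apply: runs_seq; apply: runs_step_size => //.
  - exact: stored_customer st.
  - exact: stored_remaining st.
  - exact: stored_weight st.
  apply: runs_seq; apply: (@runs_map_entries _ _ _ _ (load c')) => //.
  - exact: stored_m st.
  - by move=> r; rewrite /= valK !mxE -(stored_load st) mxE.
  apply: runs_seq; apply: (@runs_map_entries _ _ _ _ (price c')) => //.
  - exact: stored_m st.
  - by move=> r; rewrite /= valK !mxE -(stored_price st) (stored_rate st) mxE.
  apply: runs_sum_entries => //; first exact: stored_m st.
  rewrite !read_vecE; split=> //; case: st => *; split; rewrite ?read_vecE //.
- by [].
- lia.
Qed.

Lemma runs_start_phase s Q :
  Q (set_rmem (set_rmem (set_ivar s Customer 0)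
       Scalars Remaining (rmem s Scalars Weight))
       Scalars StartSum (rmem s Scalars PriceSum)) ->
  runs f start_phase_cmd s 3 0 Q.
Proof.
move=> Qs; apply: (runs_seq (t1 := 1) (t2 := 2) (q1 := 0) (q2 := 0)); apply: runs_iset.
by apply: (runs_seq (t1 := 1) (t2 := 1) (q1 := 0) (q2 := 0)); do 2!apply: runs_rset.
Qed.

Lemma runs_record_dual c s : stores c s -> rmem s Scalars PriceSum = price_sum c ->
  runs f record_dual_cmd s (3 * m + 4) 0 (fun s' =>
    [/\ ivar s' NumCustomers = n, ivar s' NumResources = m,
        forall k, k != Growth -> rmem s' Scalars k = rmem s Scalars k,
        rmem s' Scalars Growth = best_growth (complete_phase c)
      & [/\ read_vec m s' Prices = price c, read_vec m s' Loads = load c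
           & read_vec m s' Dual = dual_candidate (complete_phase c)]]).
Proof.
move=> st sumE; apply: runs_le; last first.
  apply: runs_if => /=; rewrite sumE (stored_growth st) (stored_start st) => better.
    apply: runs_seq; apply: runs_rset.
    apply: (@runs_map_entries _ _ _ _ (dual_candidate (complete_phase c))) => //.
    - exact: stored_m st.
    - move=> r; rewrite /= better mxE -(stored_price st) mxE.
      by rewrite sumE mulrC.
    split; [exact: stored_n st|exact: stored_m st| | |].
    + by move=> k /negbTE kE; rewrite /= kE.
    + by rewrite /= sumE (stored_start st) /Num.max better.
    + by rewrite !read_vecE //; case: st.
  apply: runs_skip; rewrite /= /Num.max (negbTE better).
  by case: st => *; split=> //; split.
- by [].
- lia.
Qed.

Lemma runs_end_phase c s : stores c s -> rmem s Scalars PriceSum = price_sum c ->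
  runs f end_phase_cmd s (3 * m + 10) 0 (stores (end_phase n e c)).
Proof.
move=> st sumE; apply: runs_le; last first.
  rewrite /end_phase /aborts; apply: runs_if => /=;
    rewrite sumE (stored_rate st) (stored_start st) => abort;
    rewrite ?abort ?(negbTE abort).
    apply: runs_seq; apply: runs_rset; apply: runs_start_phase.
    by split; rewrite ?read_vecE //= ?(stored_weight st) //; case: st.
  apply: runs_if => /=; rewrite (stored_n st) (stored_customer st) => mid_phase;
    rewrite ?mid_phase ?(negbTE mid_phase); first exact: runs_skip.
  apply: runs_seq; apply: runs_impl (runs_record_dual st sumE).
  move=> s' [n' m' scalars' growth' [price' load' dual']].
  apply: runs_seq; apply: runs_rset; apply: runs_start_phase.
  split; rewrite ?read_vecE //= ?scalars' //; try by case: st.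
  by rewrite (stored_total st) (stored_weight st).
- by [].
- lia.
Qed.

End Simulation.

Section StageProgram.
Variables (R : realType) (n m : nat).
Variables (X : 'I_n -> set 'rV[R]_m) (f : 'I_n -> 'rV[R]_m -> 'rV[R]_m).
Variable sigma : R.
Hypothesis X_inst : rs_instance X.
Hypothesis f_solver : block_solver sigma X f.
Hypothesis sigma_ge1 : 1 <= sigma.
Hypothesis m_gt0 : (0 < m)%N.
Hypothesis n_gt0 : (0 < n)%N.
Variables delta l e Phi w : R.
Hypothesis e_gt0 : 0 < e.
Hypothesis e_le1 : e <= 1.
Hypothesis Phi_ge0 : 0 <= Phi.
Hypothesis w_gt0 : 0 < w.
Implicit Types (c : config R m) (s : state R).

Record stage_input s : Prop := StageInput {
  input_n : ivar s NumCustomers = n;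
  input_m : ivar s NumResources = m;
  input_delta : rmem s Scalars Delta = delta;
  input_log : rmem s Scalars Log = l;
  input_rate : rmem s Scalars Rate = e;
  input_target : rmem s Scalars Target = Phi;
  input_weight : rmem s Scalars Weight = w }.

Lemma runs_init_stage s : stage_input s ->
  runs f init_stage_cmd s (9 * m + 12) 0
    (stores n delta l e Phi (initial w (read_vec m s Dual))).
Proof.
move=> input; apply: runs_le; last first.
  apply: runs_seq; apply: (@runs_map_entries _ _ _ _ (const_mx 1)) => //.
  - exact: input_m input.
  - by move=> r; rewrite mxE.
  apply: runs_seq; apply: (@runs_map_entries _ _ _ _ 0) => //.
  - exact: input_m input.
  - by move=> r; rewrite mxE.
  apply: runs_seq; apply: runs_sum_entries => //; first exact: input_m input.
  do 2!(apply: runs_seq; apply: runs_rset); apply: runs_start_phase.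
  by split; rewrite ?read_vecE //= ?(input_weight input) //; case: input.
- by [].
- lia.
Qed.

Lemma runs_phase_loop_body c s : stage_inv X f sigma e Phi w c -> unfinished Phi c ->
  stores n delta l e Phi c s ->
  runs f (oracle_step_cmd ;; end_phase_cmd) s (16 * m + 25) 1
    (stores n delta l e Phi (step f e c)).
Proof.
move=> inv c_unf st.
rewrite (_ : 16 * m + 25 = 13 * m + 15 + (3 * m + 10))%N; last by ring.
rewrite -[1%N]addn0.
have oracle := runs_oracle_step (C := Ordinal (stage_customer inv)) f st erefl
  (phase_price_ge0 (stage_phase inv)).
apply: runs_seq; apply: runs_impl oracle => s' [st' sumE].
exact: runs_end_phase.
Qed.

Lemma runs_stage s : stage_input s -> exists c,
  runs f stage_cmd s ((16 * m + 26) * calls c + 9 * m + 13) (calls c)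
    (fun s' => [/\ stage_inv X f sigma e Phi w c, ~~ unfinished Phi c
                 & stores n delta l e Phi c s']).
Proof.
move=> input; pose I j s' := exists c, [/\ stage_inv X f sigma e Phi w c, calls c = j
  & stores n delta l e Phi c s'].
have [B calls_le] := stage_calls_bounded f X_inst sigma_ge1 m_gt0 Phi w e_gt0.
have bounded j s' : I j s' -> (j <= B)%N by move=> [c [/calls_le + <-]].
have loop_body j s' :
    I j s' -> beval s' (BRLt (cell Total) (cell Target * cell Weight)) ->
    runs f (oracle_step_cmd ;; end_phase_cmd) s' (16 * m + 25) 1 (I j.+1).
  move=> [c [inv <- st]] /=.
  rewrite (stored_total st) (stored_target st) (stored_weight st) => c_unf.
  apply: runs_impl (runs_phase_loop_body inv c_unf st) => s'' st''.
  exists (step f e c); split=> //; first exact: stage_inv_step.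
  by rewrite /step /end_phase; do 2!case: ifP => _ //.
pose c0 := initial w (read_vec m s Dual).
have start s' : stores n delta l e Phi c0 s' -> I 0%N s'.
  by move=> st; exists c0; split=> //; exact: stage_inv_initial.
have [j [s' [t [q [run t_le q_le [[c [inv callsE st]]]]]]]] := runs_bind
  (runs_init_stage input) (fun s' st => runs_while loop_body bounded (start s' st)).
rewrite /= (stored_total st) (stored_target st) (stored_weight st) => finished.
exists c, s', t, q; split=> //.
- by apply: leq_trans t_le _; rewrite callsE; lia.
- by apply: leq_trans q_le _; rewrite callsE; lia.
Qed.

End StageProgram.

Definition log_cmd : cmd :=
  ISet Power (ICst 1) ;;
  set_cell Log (RCst 1) ;;
  While (BILt (IVar Power) (IVar NumResources))
    (ISet Power (IAdd (IVar Power) (IVar Power)) ;;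
     set_cell Log (cell Log + RCst 1)).

Definition add_answer_cmd : cmd :=
  Call (IVar Customer) Prices Answer ;;
  map_entries Loads (entry Loads + entry Answer) ;;
  ISet Customer (IAdd (IVar Customer) (ICst 1)).

Definition first_load_cmd : cmd :=
  map_entries Prices (RCst 1) ;;
  While (BILt (IVar Customer) (IVar NumCustomers)) add_answer_cmd ;;
  sum_entries Loads FirstLoad.

Definition prepare_cmd : cmd := log_cmd ;; first_load_cmd.

(* At the end of the first stage, [lambda_star X * w] lies between [1 / (4 * s)] and
   [load_factor s], for any [s >= sigma]. *)
Definition load_factor (s : nat) : nat := 24 + 8 * s.

Definition phase_factor (s : nat) : nat := 16 * s * s * load_factor s.

Definition coarse_setup_cmd (s : nat) : cmd :=
  sum_entries Prices PriceSum ;;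
  set_cell Weight (RCst s * cell PriceSum / cell FirstLoad) ;;
  set_cell Rate (RCst 1) ;;
  set_cell Target (cell Log).

Definition coarse_cmd (s : nat) : cmd := coarse_setup_cmd s ;; stage_cmd.

Definition fine_setup_cmd (s : nat) : cmd :=
  set_cell Weight (cell Weight / RCst (4 * s * load_factor s)) ;;
  set_cell Rate (cell Delta / RCst 4) ;;
  set_cell Target (RCst (phase_factor s) * cell Log / (cell Rate * cell Rate)).

Definition average_loads_cmd : cmd := map_entries Loads (entry Loads / cell Total).

Definition fine_cmd (s : nat) : cmd :=
  fine_setup_cmd s ;;
  stage_cmd ;;
  average_loads_cmd.

Definition trivial_dual_cmd : cmd := RSet Dual (ICst 0) (RCst 1).

Definition solve_cmd (s : nat) : cmd :=
  If (BRLt (RCst 0) (cell FirstLoad)) (coarse_cmd s ;; fine_cmd s) trivial_dual_cmd.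

Definition sharing_program (s : nat) : cmd :=
  prepare_cmd ;; solve_cmd s.

Definition log_size (m : nat) : nat := (up_log 2 m).+1.

Section Preparation.
Variables (R : realType) (n m : nat) (f : 'I_n -> 'rV[R]_m -> 'rV[R]_m) (delta : R).
Hypothesis m_gt0 : (0 < m)%N.
Implicit Types s : state R.

Definition first_load : 'rV[R]_m := \sum_C f C (const_mx 1).

Lemma runs_log s Q : ivar s NumResources = m ->
  Q (set_rmem (set_ivar s Power (2 ^ up_log 2 m)) Scalars Log (log_size m)%:R) ->
  runs f log_cmd s (3 * m + 3) 0 Q.
Proof.
move=> sm Qs; apply: (@runs_le _ _ _ _ (1 + (1 + (3 * m + 1))) (0 + (0 + 0)));
  [lia|by []|].
apply: runs_seq; apply: runs_iset; apply: runs_seq; apply: runs_rset.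
pose T j : state R := set_rmem (set_ivar s Power (2 ^ j)) Scalars Log j.+1%:R.
pose I j s' := (j <= up_log 2 m)%N /\ s' = T j.
have bounded j s' : I j s' -> (j <= up_log 2 m)%N by case.
have loop_body j s' : I j s' -> beval s' (BILt (IVar Power) (IVar NumResources)) ->
    runs f (ISet Power (IAdd (IVar Power) (IVar Power)) ;;
            set_cell Log (cell Log + RCst 1)) s' (1 + 1) (0 + 0) (I j.+1).
  move=> [_ ->] /=; rewrite sm => pow_lt; apply: runs_seq; apply: runs_iset.
  apply: runs_rset; split.
    rewrite ltnNge; apply: contraL pow_lt => log_le; rewrite -leqNgt.
    exact: leq_trans (up_logP m (ltnSn 1)) (leq_pexp2l (ltn0Sn 1) log_le).
  apply: state_eq => [v|a i] /=; first by case: eqP => //; rewrite expnS; lia.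
  by case: ifP => [_|->//]; rewrite natr1.
have [j [s' [t [q [run t_le q_le [[j_le s'E]]]]]]] :=
  runs_while loop_body bounded (conj (leq0n _) erefl : I 0%N (T 0%N)).
rewrite s'E /= sm -leqNgt => pow_ge.
have jE : j = up_log 2 m by apply/eqP; rewrite eqn_leq j_le up_log_min.
exists s', t, q; split=> //; last by rewrite s'E jE.
have : (j <= m)%N by rewrite jE up_log_min // ltnW // ltn_expl.
lia.
Qed.

Record loading j s : Prop := Loading {
  loading_j : (j <= n)%N;
  loading_n : ivar s NumCustomers = n;
  loading_m : ivar s NumResources = m;
  loading_customer : ivar s Customer = j;
  loading_delta : rmem s Scalars Delta = delta;
  loading_log : rmem s Scalars Log = (log_size m)%:R;
  loading_price : read_vec m s Prices = const_mx 1;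
  loading_load : read_vec m s Loads = \sum_(C < n | (C < j)%N) f C (const_mx 1);
  loading_dual : read_vec m s Dual = 0 }.

Lemma runs_add_answer j s : loading j s -> (j < n)%N ->
  runs f add_answer_cmd s (3 * m + 4) 1 (loading j.+1).
Proof.
move=> ld j_lt; apply: (@runs_le _ _ _ _ (1 + (3 * m + 2 + 1)) (1 + (0 + 0)));
  [lia|by []|].
apply: runs_seq; apply: (runs_call (C := Ordinal j_lt)).
- exact: loading_customer ld.
- by rewrite (loading_price ld) => r; rewrite mxE.
rewrite (loading_price ld); apply: runs_seq.
apply: (@runs_map_entries _ _ _ _ (\sum_(C < n | (C < j.+1)%N) f C (const_mx 1))) => //.
- exact: loading_m ld.
- move=> r; rewrite /= valK (bigD1 (Ordinal j_lt)) //= [RHS]mxE addrC; congr (_ + _).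
  rewrite (eq_bigl (fun C : 'I_n => (C < j)%N)) => [|C].
    by rewrite -(loading_load ld) mxE.
  by rewrite -val_eqE /= ltnS ltn_neqAle andbC.
by apply: runs_iset; case: ld => *; split; rewrite ?read_vecE //= addn1; congr S.
Qed.

Record prepared s : Prop := Prepared {
  prepared_n : ivar s NumCustomers = n;
  prepared_m : ivar s NumResources = m;
  prepared_delta : rmem s Scalars Delta = delta;
  prepared_log : rmem s Scalars Log = (log_size m)%:R;
  prepared_first_load : rmem s Scalars FirstLoad = \sum_r first_load 0 r;
  prepared_price : read_vec m s Prices = const_mx 1;
  prepared_load : read_vec m s Loads = first_load;
  prepared_dual : read_vec m s Dual = 0 }.

Lemma runs_prepare :
  runs f prepare_cmd (init_state n m delta) ((3 * m + 5) * n + 9 * m + 9) n prepared.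
Proof.
apply: (@runs_le _ _ _ _
  (3 * m + 3 + (3 * m + 2 + ((3 * m + 4).+1 * n + 1 + (3 * m + 3))))
  (0 + (0 + (1 * n + 0)))); [lia|lia|].
apply: runs_seq; apply: runs_log => //; apply: runs_seq.
apply: (@runs_map_entries _ _ _ _ (const_mx 1)) => // [r|]; first by rewrite mxE.
set s0 := set_ivar _ _ _.
have ld0 : loading 0 s0.
  split; rewrite ?read_vecE //=; last by apply/rowP => r; rewrite !mxE.
  by rewrite big_pred0 //; apply/rowP => r; rewrite !mxE.
have bounded j s : loading j s -> (j <= n)%N by exact: loading_j.
have loop_body j s :
    loading j s -> beval s (BILt (IVar Customer) (IVar NumCustomers)) ->
    runs f add_answer_cmd s (3 * m + 4) 1 (loading j.+1).
  move=> ld /=; rewrite (loading_customer ld) (loading_n ld); exact: runs_add_answer.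
have [j run] := runs_while loop_body bounded ld0; apply: runs_seq.
have [s' [_ [_ [_ _ _ [ld]]]]] := run.
rewrite /= (loading_customer ld) (loading_n ld) -leqNgt => n_le.
have jE : j = n by apply/eqP; rewrite eqn_leq n_le (loading_j ld).
rewrite jE in run; apply: runs_impl run => {}s' [{}ld _].
apply: runs_sum_entries => //; first exact: loading_m ld.
have load_all : \sum_(C < n | (C < n)%N) f C (const_mx 1) = first_load.
  by apply: eq_bigl => C; rewrite ltn_ord.
split; rewrite ?read_vecE ?(loading_load ld) ?load_all //; by case: ld.
Qed.

End Preparation.

(** * Analysis of the two stages *)

Section Stages.
Variables (R : realType) (n m : nat).
Variables (X : 'I_n -> set 'rV[R]_m) (f : 'I_n -> 'rV[R]_m -> 'rV[R]_m).
Variable sigma : R.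
Hypothesis X_inst : rs_instance X.
Hypothesis f_solver : block_solver sigma X f.
Hypothesis sigma_ge1 : 1 <= sigma.
Hypothesis m_gt0 : (0 < m)%N.
Implicit Types (c : config R m) (x z : 'rV[R]_m).

Local Notation lam := (lambda_star X).
Let lam_ge0 : 0 <= lam := lambda_ge0 X_inst.

Definition approximate_solution (delta : R) x z : Prop :=
  [/\ minkowski_sum X x, simplex z,
      `|x| <= (1 + delta) * sigma * lam,
      (1 - delta) * (lam / sigma) <= min_dot (minkowski_sum X) z
    & forall (S : {set 'I_m}) (mu : R), 0 <= mu -> local_weak_duality f S mu ->
        \big[Num.max/0]_(r in S) x 0 r <= mu + delta * Num.max lam mu].

Let unit_price_ge0 : nonneg_vec (const_mx 1 : 'rV[R]_m).
Proof. by move=> r; rewrite mxE. Qed.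

Lemma first_load_minkowski_sum : minkowski_sum X (first_load f).
Proof.
exists (fun C => f C (const_mx 1)) => // C.
exact: (solver_in f_solver C unit_price_ge0).
Qed.

Lemma lambda_le_first_load : lam <= \sum_r first_load f 0 r.
Proof.
have load_ge0 := minkowski_sum_ge0 X_inst first_load_minkowski_sum.
apply: (lambda_le_coord X_inst first_load_minkowski_sum); first exact: sumr_ge0.
by move=> r; exact: ler_sum_coord.
Qed.

Lemma first_load_le : \sum_r first_load f 0 r <= sigma * (lam * m%:R).
Proof.
have -> : \sum_r first_load f 0 r = dotr (const_mx 1) (first_load f).
  by apply: eq_bigr => r _; rewrite [const_mx _ _ _]mxE mul1r.
rewrite dotr_sumr; apply: (@le_trans _ _ (sigma * \sum_C opt X C (const_mx 1))).
  by rewrite mulr_sumr; apply: ler_sum => C _; exact: solver_le.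
rewrite ler_wpM2l ?(le_trans ler01) // -(sum_const_mx1 R m).
exact: sum_opt_le.
Qed.

Lemma trivial_approximate_solution delta : 0 <= delta ->
  \sum_r first_load f 0 r <= 0 ->
  approximate_solution delta (first_load f) (\row_r ((r : nat) == 0%N)%:R).
Proof.
move=> delta_ge0 load_le0.
have lam0 : lam = 0.
  by apply/eqP; rewrite eq_le lam_ge0 (le_trans lambda_le_first_load).
have load_ge0 := minkowski_sum_ge0 X_inst first_load_minkowski_sum.
have load0 : first_load f = 0.
  apply/rowP => r; rewrite [RHS]mxE; apply/eqP; rewrite eq_le load_ge0 andbT.
  exact: le_trans (ler_sum_coord r load_ge0) load_le0.
have z_ge0 : nonneg_vec (\row_(r < m) ((r : nat) == 0%N)%:R : 'rV[R]_m).
  by move=> r; rewrite mxE.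
split.
- exact: first_load_minkowski_sum.
- split=> [r|]; first by rewrite mxE ler0n lern1 leq_b1.
  rewrite (bigD1 (Ordinal m_gt0)) //= big1 ?addr0 ?mxE ?eqxx ?normr1 // => r.
  by rewrite -val_eqE mxE /= => /negbTE ->; rewrite normr0.
- by rewrite load0 normr0 lam0 mulr0.
- rewrite lam0 mul0r mulr0.
  exact: (min_dot_ge0 (minkowski_sum_neq0 X_inst) (minkowski_sum_ge0 X_inst)).
- move=> S mu mu_ge0 _.
  have bound_ge0 : 0 <= mu + delta * Num.max lam mu.
    by rewrite addr_ge0 // mulr_ge0 // le_max lam_ge0.
  by apply/bigmax_leP; split=> // r _; rewrite load0 mxE.
Qed.

Section CoarseStage.
Variables (s L : nat) (w0 : R).
Hypothesis sigma_le : sigma <= s%:R.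
Hypothesis L_gt0 : (0 < L)%N.
Hypothesis m_le : (m <= 2 ^ L)%N.
Hypothesis lam_w0_ge1 : 1 <= lam * w0.
Hypothesis lam_w0_le : lam * w0 <= s%:R * m%:R.
Variable c : config R m.
Hypothesis inv : stage_inv X f sigma 1 L%:R w0 c.

Let lam_w_ge0 : 0 <= lam * weight c.
Proof. by rewrite mulr_ge0 // ltW // (phase_weight_gt0 (stage_phase inv)). Qed.

Lemma coarse_aborted_le : (aborted c <= 2 + 2 * s + L)%N.
Proof.
have [->//|/(pow_aborted_lt inv) pow_lt] := posnP (aborted c).
have {}pow_lt : (2 ^ aborted c < 4 * s * s * m)%N.
  rewrite -(ltr_nat R) natrX; apply: lt_le_trans pow_lt _.
  rewrite !natrM -!mulrA ler_pM2l //.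
  by rewrite ler_pM ?(le_trans ler01) // (le_trans ler01).
have pow_ge : (4 * s * s * m <= 2 ^ (2 + 2 * s + L))%N.
  rewrite (_ : (2 + 2 * s + L)%N = (2 + s + s + L)%N); last lia.
  by rewrite !expnD !leq_mul // ltnW // ltn_expl.
by rewrite ltnW // -(ltn_exp2l _ _ (ltnSn 1)) (leq_trans pow_lt).
Qed.

Lemma coarse_phases_le : (completed c + aborted c <= (5 + 2 * s) * L)%N.
Proof.
have : (completed c <= L.+1)%N by rewrite -(ler_nat R) -natr1 (stage_completed inv).
have := coarse_aborted_le; nia.
Qed.

Lemma coarse_load_bound_le :
  (1 + 1) / 1 * (ln m%:R + 1 * (2 * (completed c + aborted c)%:R + 1))
    <= (L * load_factor s)%:R :> R.
Proof.
rewrite divr1 mul1r; have ln_le := ln_natr_le_log R m_gt0 m_le.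
apply: (@le_trans _ _ (2 * (L%:R + (2 * (completed c + aborted c) + 1)%:R))).
  by rewrite [(_ + 1)%:R]natrD [(2 * _)%:R]natrM ler_pM2l // lerD2r.
rewrite -natrD -natrM ler_nat /load_factor.
have := coarse_phases_le; nia.
Qed.

Lemma coarse_weight_le : ~~ unfinished L%:R c -> lam * weight c <= (load_factor s)%:R.
Proof.
rewrite /unfinished -leNgt => total_ge.
have load_le r : load c 0 r <= (L * load_factor s)%:R.
  exact: le_trans (stage_load_le m_gt0 ltr01 inv r) coarse_load_bound_le.
have L_pos : 0 < L%:R :> R by rewrite ltr0n.
rewrite -(ler_pM2l L_pos) -natrM.
apply: le_trans (lambda_total_le X_inst (stage_phase inv) m_gt0 load_le).
by rewrite mulrCA ler_wpM2l.
Qed.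

Lemma coarse_weight_ge : 1 <= 4 * s%:R * (lam * weight c).
Proof.
have s_ge1 : 1 <= s%:R :> R := le_trans sigma_ge1 sigma_le.
have [no_abort|/(stage_aborted inv)/ltW lt] := posnP (aborted c).
  have -> : weight c = w0 by rewrite -(stage_weight inv) no_abort expr0 mulr1.
  by apply: le_trans lam_w0_ge1 _; rewrite ler_peMl ?(le_trans ler01) //; lra.
by apply: le_trans lt _; rewrite -!mulrA ler_pM2l // ler_wpM2r.
Qed.

Lemma coarse_calls_le : (calls c <= (n + m) * L * load_factor s)%N.
Proof.
rewrite -(ler_nat R); apply: le_trans (stage_calls_le m_gt0 ltr01 inv) _.
rewrite -mulnA [leRHS]natrM [(n + m)%:R]natrD [leRHS]mulrDl.
rewrite lerD // ler_wpM2l ?coarse_load_bound_le //.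
rewrite natr1 ler_nat /load_factor; have := coarse_phases_le; nia.
Qed.

End CoarseStage.

Section FineStage.
Variables (L : nat) (factor delta w0 : R).
Hypothesis L_gt0 : (0 < L)%N.
Hypothesis m_le : (m <= 2 ^ L)%N.
Hypothesis factor_ge1 : 1 <= factor.
Hypothesis delta_gt0 : 0 < delta.
Hypothesis delta_le1 : delta <= 1.
Hypothesis lam_w0_le : sigma * lam * w0 <= 4^-1.
Hypothesis lam_w0_ge : 1 <= factor * (lam * w0).

Let e : R := delta / 4.
Let Phi : R := factor * L%:R / e ^+ 2.

Variable c : config R m.
Hypothesis inv : stage_inv X f sigma e Phi w0 c.

Let e_gt0 : 0 < e. Proof. by rewrite divr_gt0. Qed.
Let e_le_quarter : e <= 4^-1.
Proof. by rewrite /e; move: delta_le1; lra. Qed.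
Let e_le1 : e <= 1.
Proof. by move: e_le_quarter; lra. Qed.
Let Phi_gt0 : 0 < Phi.
Proof. by rewrite divr_gt0 ?exprn_gt0 // mulr_gt0 ?ltr0n // (lt_le_trans ltr01). Qed.
Let ln_le : ln m%:R <= L%:R :> R := ln_natr_le_log R m_gt0 m_le.

Lemma fine_no_abort : aborted c = 0%N.
Proof.
apply/eqP; rewrite -leqn0 leqNgt; apply/negP => /(pow_aborted_lt inv).
have : 1 <= 2 ^+ aborted c :> R by rewrite exprn_ege1 // ler1n.
by move: lam_w0_le; lra.
Qed.

Lemma fine_approximate_solution : ~~ unfinished Phi c ->
  approximate_solution delta ((total_weight c)^-1 *: load c) (dual_candidate c).
Proof.
move=> finished; have no_abort := fine_no_abort.
have wE : weight c = w0 by rewrite -(stage_weight inv) no_abort expr0 mulr1.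
have w_gt0 := phase_weight_gt0 (stage_phase inv).
have total_ge : Phi * weight c <= total_weight c by rewrite leNgt.
have total_gt0 : 0 < total_weight c by rewrite (lt_le_trans _ total_ge) // mulr_gt0.
have weight_le : sigma * lam * weight c <= 4^-1 by rewrite wE.
have long_run : ln m%:R <= e ^+ 2 * (lam * total_weight c).
  apply: le_trans ln_le _; apply: (@le_trans _ _ (e ^+ 2 * (lam * (Phi * weight c)))).
    rewrite (_ : e ^+ 2 * _ = L%:R * (factor * (lam * w0))); first by rewrite ler_peMr.
    by rewrite /Phi wE; field; rewrite gt_eqF.
  by rewrite ler_pM2l ?exprn_gt0 // ler_wpM2l.
have deltaE : delta = 4 * e by rewrite /e; field.
have [z_simplex dual_ge] := finished_dual X_inst sigma_ge1 m_gt0 e_gt0 inv finished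
  no_abort e_le_quarter total_gt0 weight_le long_run.
rewrite deltaE; split=> //.
- exact: (finished_minkowski_sum inv finished no_abort total_gt0).
- exact: (finished_norm_le X_inst f_solver sigma_ge1 m_gt0 e_gt0 e_le1 inv).
- exact: (finished_lwd X_inst f_solver sigma_ge1 m_gt0 e_gt0 e_le1 inv).
Qed.

Lemma fine_calls_le : (calls c)%:R <= (n + m)%:R * L%:R * (128 * factor) / delta ^+ 2.
Proof.
have L_le_Phi : L%:R / e <= Phi.
  rewrite ler_pdivrMr // (_ : Phi * e = L%:R * (factor / e)); last first.
    by rewrite /Phi; field; rewrite gt_eqF.
  by rewrite ler_peMr // ler_pdivlMr // mul1r (le_trans e_le1).
have Phi_ge1 : 1 <= Phi.
  by apply: le_trans L_le_Phi; rewrite ler_pdivlMr // mul1r (le_trans e_le1) // ler1n.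
have completed_le := stage_completed inv.
apply: le_trans (stage_calls_le m_gt0 e_gt0 inv) _; rewrite fine_no_abort addn0.
have -> : (n + m)%:R * L%:R * (128 * factor) / delta ^+ 2 = (n + m)%:R * (8 * Phi).
  by rewrite /Phi /e; field; rewrite gt_eqF.
rewrite [(n + m)%:R]natrD [leRHS]mulrDl lerD // ler_wpM2l //; first by lra.
have -> : (1 + e) / e * (ln m%:R + e * (2 * (completed c)%:R + 1))
    = (1 + e) * (ln m%:R / e + (2 * (completed c)%:R + 1)).
  by field; rewrite gt_eqF.
have ln_ratio_le : ln m%:R / e <= Phi.
  by apply: le_trans L_le_Phi; rewrite ler_pM2r ?invr_gt0.
have ln_ratio_ge0 : 0 <= ln m%:R / e.
  by rewrite divr_ge0 ?(ltW e_gt0) // ln_ge0 // ler1n.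
have completed_ge0 : 0 <= (completed c)%:R :> R by [].
apply: (@le_trans _ _ ((1 + 4^-1) * (Phi + (2 * (Phi + 1) + 1)))); last by lra.
by apply: ler_pM; move: e_gt0 e_le_quarter; lra.
Qed.

End FineStage.
End Stages.

Definition call_factor (s : nat) : nat :=
  6 * (1 + load_factor s + 128 * phase_factor s).

Definition call_bound (R : realType) (n m : nat) (delta : R) : R :=
  (n + m)%:R / delta ^+ 2 * ln (maxn m 2)%:R.

Lemma log_size_le (R : realType) m : (log_size m)%:R <= 6 * ln (maxn m 2)%:R :> R.
Proof.
have max_ge2 : (2 <= maxn m 2)%N by rewrite leq_maxr.
have ln_max_ge k : (k <= maxn m 2)%N -> (0 < k)%N -> ln k%:R <= ln (maxn m 2)%:R :> R.
  by move=> k_le k_gt0; rewrite ler_ln ?posrE ?ltr0n ?(leq_trans k_gt0) // ler_nat.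
have ln_ge_half := le_trans (ln2_ge_half R) (ln_max_ge 2%N max_ge2 isT).
rewrite /log_size; have [->|log_gt0] := posnP (up_log 2 m); first by lra.
have m_gt1 : (1 < m)%N by move: log_gt0; rewrite up_log_gt0.
have : ((up_log 2 m).-1)%:R * 2^-1 <= ln (maxn m 2)%:R :> R.
  apply: (@le_trans _ _ (ln (2 ^ (up_log 2 m).-1)%:R)).
    by rewrite natrX lnXn // -[leRHS]mulr_natl ler_wpM2l // ln2_ge_half.
  apply: ln_max_ge; rewrite ?expn_gt0 // (leq_trans (ltnW (up_log_gtn _ m_gt1))) //.
  exact: leq_maxl.
have -> : (up_log 2 m).+1%:R = (up_log 2 m).-1%:R + 2 :> R.
  by rewrite -[in LHS](prednK log_gt0) -addn2 natrD.
by lra.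
Qed.

Lemma calls_le_call_bound (R : realType) (n m s q : nat) (delta : R) :
  0 < delta -> delta <= 1 ->
  q%:R <= n%:R + ((n + m) * log_size m * load_factor s)%:R
    + (n + m)%:R * (log_size m)%:R * (128 * (phase_factor s)%:R) / delta ^+ 2 ->
  q%:R <= (call_factor s)%:R * call_bound n m delta.
Proof.
move=> delta_gt0 delta_le1 /le_trans; apply.
have delta2_gt0 : 0 < delta ^+ 2 by rewrite exprn_gt0.
pose T : R := (n + m)%:R * (log_size m)%:R / delta ^+ 2.
have T_ge : ((n + m) * log_size m)%:R <= T.
  rewrite natrM ler_pdivlMr // ler_piMr ?mulr_ge0 // expr_le1 //; exact: ltW.
have n_le : n%:R <= T.
  by apply: le_trans T_ge; rewrite ler_nat (leq_trans (leq_addr m n)) ?leq_pmulr.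
pose F : R := 1 + (load_factor s)%:R + 128 * (phase_factor s)%:R.
apply: (@le_trans _ _ (T * F)).
  rewrite 2!mulrDr mulr1 2?lerD //; first by rewrite natrM ler_wpM2r.
  by rewrite le_eqVlt; apply/orP; left; apply/eqP; rewrite /T; ring.
have F_ge0 : 0 <= F by rewrite /F -addrA addr_ge0 // addr_ge0 // mulr_ge0.
have -> : (call_factor s)%:R * call_bound n m delta
    = (n + m)%:R / delta ^+ 2 * (6 * ln (maxn m 2)%:R) * F.
  rewrite /call_factor /call_bound /F [(6 * _)%:R]natrM 2!natrD [(128 * _)%:R]natrM.
  by ring.
rewrite ler_wpM2r // /T mulrAC ler_wpM2l ?log_size_le //.
by rewrite divr_ge0 // ltW.
Qed.

Lemma steps_le_polynomial (R : realType) (n m K q t : nat) (delta : R) :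
  (0 < m)%N -> 0 < delta -> delta <= 1 ->
  q%:R <= K%:R * call_bound n m delta -> (t <= 60 * m.+1 * q.+1)%N ->
  t%:R <= (60 * K.+1)%:R * ((n + m)%:R + delta^-1) ^+ 5.
Proof.
move=> m_gt0 delta_gt0 delta_le1 q_le t_le; set B := (n + m)%:R + delta^-1.
have inv_ge1 : 1 <= delta^-1 by rewrite invf_ge1.
have nm_ge : m%:R <= (n + m)%:R :> R by rewrite ler_nat leq_addl.
have m_ge1 : 1 <= m%:R :> R by rewrite ler1n.
have B_ge2 : 2 <= B by rewrite /B; lra.
have B_ge0 : 0 <= B by lra.
have m1_le : m.+1%:R <= B by rewrite -natr1 lerD // ?(le_trans nm_ge).
have ln_le : ln (maxn m 2)%:R <= B.
  apply: (@le_trans _ _ (maxn m 2)%:R).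
    by rewrite ltW // ln_sublinear // ltr0n leq_max orbT.
  by rewrite -maxEnat natr_max ge_max B_ge2 andbT; move: nm_ge inv_ge1; rewrite /B; lra.
have bound_le : call_bound n m delta <= B ^+ 4.
  have ln_ge0 : 0 <= ln (maxn m 2)%:R :> R by rewrite ln_ge0 // ler1n leq_max orbT.
  rewrite (_ : B ^+ 4 = B * B ^+ 2 * B); last by ring.
  rewrite /call_bound -exprVn ler_pM ?mulr_ge0 ?exprn_ge0 ?invr_ge0 ?(ltW delta_gt0) //.
  rewrite ler_pM ?exprn_ge0 ?invr_ge0 ?(ltW delta_gt0) //; first by rewrite lerDl; lra.
  by rewrite lerXn2r ?nnegrE //; [lra|rewrite lerDr].
have q1_le : q.+1%:R <= K.+1%:R * B ^+ 4.
  rewrite -!natr1 mulrDl mul1r lerD ?exprn_ege1 //; last by lra.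
  by apply: le_trans q_le _; rewrite ler_wpM2l.
apply: (@le_trans _ _ (60 * m.+1 * q.+1)%:R); first by rewrite ler_nat.
rewrite !natrM (_ : 60 * K.+1%:R * B ^+ 5 = 60 * B * (K.+1%:R * B ^+ 4)); last by ring.
by rewrite ler_pM ?mulr_ge0 // ler_pM2l.
Qed.

Section Correctness.
Variables (R : realType) (n m : nat).
Variables (X : 'I_n -> set 'rV[R]_m) (f : 'I_n -> 'rV[R]_m -> 'rV[R]_m).
Variables (sigma delta : R) (s : nat).
Hypothesis X_inst : rs_instance X.
Hypothesis f_solver : block_solver sigma X f.
Hypothesis sigma_ge1 : 1 <= sigma.
Hypothesis sigma_le : sigma <= s%:R.
Hypothesis m_gt0 : (0 < m)%N.
Hypothesis delta_gt0 : 0 < delta.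
Hypothesis delta_le1 : delta <= 1.
Implicit Types st : state R.

Local Notation lam := (lambda_star X).
Local Notation first_sum := (\sum_r first_load f 0 r).
Let s_ge1 : 1 <= s%:R :> R := le_trans sigma_ge1 sigma_le.
Let s_gt0 : (0 < s)%N. Proof. by rewrite -(ler_nat R). Qed.
Let m_le_pow : (m <= 2 ^ log_size m)%N.
Proof. by rewrite (leq_trans (up_logP m (ltnSn 1))) // leq_exp2l. Qed.

Definition solved st : Prop :=
  approximate_solution X f sigma delta (read_vec m st Loads) (read_vec m st Dual).

Lemma coarse_start_bounds : 0 < first_sum ->
  [/\ 0 < s%:R * m%:R / first_sum, 1 <= lam * (s%:R * m%:R / first_sum)
    & lam * (s%:R * m%:R / first_sum) <= s%:R * m%:R].
Proof.
move=> load_gt0; have lam_le := lambda_le_first_load X_inst f_solver.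
have load_le := first_load_le X_inst f_solver sigma_ge1.
split.
- by rewrite divr_gt0 // mulr_gt0 ?ltr0n.
- rewrite mulrA ler_pdivlMr // mul1r; apply: le_trans load_le _.
  by rewrite [leRHS]mulrCA ler_wpM2r // mulr_ge0 // (lambda_ge0 X_inst).
- by rewrite mulrCA ler_piMr ?mulr_ge0 // ler_pdivrMr // mul1r.
Qed.

Lemma customers_gt0 : 0 < first_sum -> (0 < n)%N.
Proof.
case: n f => // g; rewrite big1 ?ltxx // => r _.
by rewrite /first_load big_ord0 mxE.
Qed.

Lemma runs_coarse_setup st : prepared f delta st ->
  runs f (coarse_setup_cmd s) st (3 * m + 6) 0
    (stage_input n m delta (log_size m)%:R 1 (log_size m)%:R (s%:R * m%:R / first_sum)).
Proof.
move=> prep; apply: (@runs_le _ _ _ _ (3 * m + 3 + (1 + (1 + 1))) (0 + (0 + (0 + 0))));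
  [lia|by []|].
apply: runs_seq; apply: runs_sum_entries => //; first exact: prepared_m prep.
rewrite (prepared_price prep) sum_const_mx1.
do 2!(apply: runs_seq; apply: runs_rset); apply: runs_rset.
by split; rewrite //= ?(prepared_first_load prep) //; case: prep.
Qed.

Record estimated st : Prop := Estimated {
  estimated_n : ivar st NumCustomers = n;
  estimated_m : ivar st NumResources = m;
  estimated_delta : rmem st Scalars Delta = delta;
  estimated_log : rmem st Scalars Log = (log_size m)%:R;
  estimated_gt0 : 0 < rmem st Scalars Weight;
  estimated_le : lam * rmem st Scalars Weight <= (load_factor s)%:R;
  estimated_ge : 1 <= 4 * s%:R * (lam * rmem st Scalars Weight) }.

Lemma runs_coarse st : prepared f delta st -> 0 < first_sum -> exists q,
  runs f (coarse_cmd s) st ((16 * m + 26) * q + 12 * m + 19) q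
    (fun st' => (q <= (n + m) * log_size m * load_factor s)%N /\ estimated st').
Proof.
move=> prep load_gt0; have [w_gt0 lam_w_ge lam_w_le] := coarse_start_bounds load_gt0.
have n_gt0 := customers_gt0 load_gt0.
have [c run] := runs_bind (runs_coarse_setup prep) (fun st' input => runs_stage X_inst
  f_solver sigma_ge1 m_gt0 n_gt0 ltr01 (lexx 1) (ler0n _ _) w_gt0 input).
exists (calls c).
rewrite (_ : _ + 19 = 3 * m + 6 + ((16 * m + 26) * calls c + 9 * m + 13))%N;
  last by ring.
apply: runs_impl run => st' [inv finished stored]; split.
  exact: (coarse_calls_le X_inst sigma_ge1 m_gt0 sigma_le _ m_le_pow lam_w_ge
    lam_w_le inv).
split; rewrite ?(stored_weight stored); try by case: stored.
- exact: phase_weight_gt0 (stage_phase inv).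
- exact: (coarse_weight_le X_inst sigma_ge1 m_gt0 sigma_le _ m_le_pow _ _ inv).
- exact: (coarse_weight_ge X_inst sigma_ge1 sigma_le lam_w_ge inv).
Qed.

Local Notation fine_rate := (delta / 4).
Local Notation fine_target := ((phase_factor s)%:R * (log_size m)%:R / fine_rate ^+ 2).
Local Notation fine_calls_bound :=
  ((n + m)%:R * (log_size m)%:R * (128 * (phase_factor s)%:R) / delta ^+ 2).
Local Notation fine_weight w := (w / (4 * s * load_factor s)%:R).

Lemma fine_weight_bounds w : 0 < w -> lam * w <= (load_factor s)%:R ->
  1 <= 4 * s%:R * (lam * w) ->
  [/\ 0 < fine_weight w, sigma * lam * fine_weight w <= 4^-1
    & 1 <= (phase_factor s)%:R * (lam * fine_weight w)].
Proof.
move=> w_gt0 lam_w_le lam_w_ge.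
have g_gt0 : 0 < (load_factor s)%:R :> R by rewrite ltr0n.
have s_pos : 0 < s%:R :> R by rewrite ltr0n.
rewrite /phase_factor !natrM; split.
- by rewrite divr_gt0 // !mulr_gt0.
- rewrite (_ : sigma * _ * _ = sigma / s%:R * (lam * w / (load_factor s)%:R) * 4^-1).
    rewrite ler_piMl // mulr_ile1 ?divr_ge0 ?mulr_ge0 ?(ltW w_gt0)
      ?(lambda_ge0 X_inst) //.
    - exact: le_trans sigma_ge1.
    - by rewrite ler_pdivrMr // mul1r.
    - by rewrite ler_pdivrMr // mul1r.
  by field; rewrite !gt_eqF.
- apply: le_trans lam_w_ge _; rewrite le_eqVlt; apply/orP; left; apply/eqP.
  by field; rewrite !gt_eqF.
Qed.

Lemma runs_fine_setup st : estimated st -> runs f (fine_setup_cmd s) st 3 0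
  (stage_input n m delta (log_size m)%:R fine_rate fine_target
     (fine_weight (rmem st Scalars Weight))).
Proof.
move=> est; apply: (@runs_le _ _ _ _ (1 + (1 + 1)) (0 + (0 + 0))) => //.
do 2!(apply: runs_seq; apply: runs_rset); apply: runs_rset.
by split; rewrite //= ?(estimated_delta est) ?(estimated_log est) ?expr2 //; case: est.
Qed.

Lemma runs_fine_stage w st : 0 < first_sum -> 0 < w ->
  sigma * lam * w <= 4^-1 -> 1 <= (phase_factor s)%:R * (lam * w) ->
  stage_input n m delta (log_size m)%:R fine_rate fine_target w st ->
  exists q, runs f (stage_cmd ;; average_loads_cmd) st
    ((16 * m + 26) * q + 12 * m + 15) q
    (fun st' => q%:R <= fine_calls_bound /\ solved st').
Proof.
move=> /customers_gt0 n_gt0 w_gt0 lam_w_le lam_w_ge input.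
have rate_gt0 : 0 < fine_rate by rewrite divr_gt0.
have rate_le1 : fine_rate <= 1 by move: delta_le1; lra.
have factor_ge1 : 1 <= (phase_factor s)%:R :> R by rewrite ler1n !muln_gt0 s_gt0.
have target_ge0 : 0 <= fine_target by rewrite divr_ge0 ?mulr_ge0 ?exprn_ge0 // ltW.
have [c run] := runs_stage X_inst f_solver sigma_ge1 m_gt0 n_gt0 rate_gt0 rate_le1
  target_ge0 w_gt0 input.
exists (calls c); rewrite -[X in runs _ _ _ _ X]addn0 (_ : _ + 12 * m + 15 =
  (16 * m + 26) * calls c + 9 * m + 13 + (3 * m + 2))%N; last by ring.
apply: runs_seq; apply: runs_impl run => st' [inv finished stored].
apply: (@runs_map_entries _ _ _ _ ((total_weight c)^-1 *: load c)) => //.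
- exact: stored_m stored.
- by move=> r; rewrite /= (stored_total stored) mxE -(stored_load stored) mxE mulrC.
rewrite /solved !read_vecE // (stored_dual stored); split.
  exact: (fine_calls_le m_gt0 (ltn0Sn _) m_le_pow factor_ge1 delta_gt0 delta_le1
    lam_w_le inv).
exact: (fine_approximate_solution X_inst f_solver sigma_ge1 m_gt0 (ltn0Sn _) m_le_pow
  factor_ge1 delta_gt0 delta_le1 lam_w_le lam_w_ge inv finished).
Qed.

Lemma runs_fine st : 0 < first_sum -> estimated st -> exists q,
  runs f (fine_cmd s) st ((16 * m + 26) * q + 12 * m + 18) q
    (fun st' => q%:R <= fine_calls_bound /\ solved st').
Proof.
move=> load_gt0 est.
have [w_gt0 lam_w_le lam_w_ge] :=
  fine_weight_bounds (estimated_gt0 est) (estimated_le est) (estimated_ge est).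
have [q run] := runs_bind (runs_fine_setup est) (fun st' =>
  runs_fine_stage load_gt0 w_gt0 lam_w_le lam_w_ge (st := st')).
exists q; rewrite (_ : _ + 18 = 3 + ((16 * m + 26) * q + 12 * m + 15))%N //.
by ring.
Qed.

Lemma runs_trivial_dual st : prepared f delta st -> first_sum <= 0 ->
  runs f trivial_dual_cmd st 1 0 solved.
Proof.
move=> prep load_le0; apply: runs_rset.
have := trivial_approximate_solution X_inst f_solver m_gt0 (ltW delta_gt0) load_le0.
rewrite /solved read_vecE // (prepared_load prep).
rewrite (_ : read_vec m _ Dual = \row_r ((r : nat) == 0%N)%:R) //.
have /rowP dual0 := prepared_dual prep.
by apply/rowP => r; have := dual0 r; rewrite !mxE /= => ->; case: eqP.
Qed.

Local Notation stage_calls_bound :=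
  (((n + m) * log_size m * load_factor s)%:R + fine_calls_bound).

Lemma runs_both_stages st : prepared f delta st -> 0 < first_sum -> exists q,
  runs f (coarse_cmd s ;; fine_cmd s) st ((16 * m + 26) * q + 24 * m + 37) q
    (fun st' => q%:R <= stage_calls_bound /\ solved st').
Proof.
move=> prep load_gt0; have [q1 [st1 [t1 [p1 [run1 t1_le p1_le [q1_le est]]]]]] :=
  runs_coarse prep load_gt0.
have [q2 run2] := runs_fine load_gt0 est; exists (q1 + q2)%N.
apply: (@runs_le _ _ _ _ ((16 * m + 26) * q1 + 12 * m + 19
  + ((16 * m + 26) * q2 + 12 * m + 18)) (q1 + q2)); [lia|by []|].
apply: runs_seq; exists st1, t1, p1; split=> //.
apply: runs_impl run2 => st2 [q2_le solution]; split=> //.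
by rewrite natrD lerD // ler_nat.
Qed.

Lemma runs_solve st : prepared f delta st -> exists q,
  runs f (solve_cmd s) st ((16 * m + 26) * q + 24 * m + 38) q solved /\
  q%:R <= stage_calls_bound.
Proof.
move=> prep; have [load_le0|load_gt0] := leP first_sum 0.
  exists 0%N; split; last first.
    by rewrite addr_ge0 // divr_ge0 ?exprn_ge0 ?mulr_ge0 // ltW.
  have trivial := runs_trivial_dual prep load_le0.
  apply: (runs_le _ _ (runs_if (t1 := 0) (q1 := 0) _ (fun _ => trivial))); [lia|by []|].
  by rewrite /= (prepared_first_load prep) ltNge load_le0.
have [q run] := runs_both_stages prep load_gt0; exists q.
have [_ [_ [_ [_ _ _ [q_le _]]]]] := run; split=> //.
have {}run := runs_impl (fun st' post => proj2 post) run.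
apply: (runs_le _ _ (runs_if (t2 := 0) (q2 := 0) (fun _ => run) _)); [lia|lia|].
by rewrite /= (prepared_first_load prep) load_gt0.
Qed.

Lemma runs_sharing_program : exists t q,
  [/\ runs f (sharing_program s) (init_state n m delta) t q solved,
      q%:R <= (call_factor s)%:R * call_bound n m delta
    & (t <= 60 * m.+1 * q.+1)%N].
Proof.
have [st [t [p [prepare t_le p_le /runs_solve[q [run q_le]]]]]] :=
  runs_prepare f delta m_gt0.
exists (t + ((16 * m + 26) * q + 24 * m + 38))%N, (n + q)%N; split.
- apply: (@runs_le _ _ _ _ (t + ((16 * m + 26) * q + 24 * m + 38)) (p + q)) => //.
    by rewrite leq_add2r.
  by apply: runs_seq; exists st, t, p.
- by apply: calls_le_call_bound => //; rewrite natrD -addrA lerD2l.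
- nia.
Qed.

End Correctness.

Theorem theorem1 (R : realType) (sigma : R) (hsigma : 1 <= sigma) :
  exists (P : cmd) (K : R) (a k : nat),
  forall (n m : nat) (X : 'I_n -> set 'rV[R]_m)
         (f : 'I_n -> 'rV[R]_m -> 'rV[R]_m) (delta : R),
    (0 < m)%N -> rs_instance X -> block_solver sigma X f -> 0 < delta <= 1 ->
    exists (x z : 'rV[R]_m) (t q : nat),
      [/\ computes f P delta x z t q,
          minkowski_sum X x /\ simplex z,
          `|x| <= (1 + delta) * sigma * lambda_star X
            /\ min_dot (minkowski_sum X) z
                 >= (1 - delta) * (lambda_star X / sigma),
          forall (S : {set 'I_m}) (mu : R), 0 <= mu ->
            local_weak_duality f S mu ->
            \big[Num.max/0]_(r in S) x 0 r
              <= mu + delta * Num.max (lambda_star X) mu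
        & q%:R <= K * ((n + m)%:R / delta ^+ 2 * ln (maxn m 2)%:R)
            /\ t%:R <= a%:R * ((n + m)%:R + delta^-1) ^+ k].
Proof.
pose s := Num.bound sigma.
have sigma_le : sigma <= s%:R by rewrite ltW // archi_boundP // (le_trans ler01).
exists (sharing_program s), (call_factor s)%:R, (60 * (call_factor s).+1)%N, 5%N.
move=> n m X f delta m_gt0 X_inst f_solver /andP[delta_gt0 delta_le1].
have [t [q [[st [t' [q' [run t'_le q'_le [? ? ? ? ?]]]]] q_le t_le]]] :=
  runs_sharing_program X_inst f_solver hsigma sigma_le m_gt0 delta_gt0 delta_le1.
exists (read_vec m st Loads), (read_vec m st Dual), t', q'.
split=> //; first by exists st.
split; first by apply: le_trans q_le; rewrite ler_nat.
apply: (@le_trans _ _ t%:R); first by rewrite ler_nat.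
exact: steps_le_polynomial m_gt0 delta_gt0 delta_le1 q_le t_le.
Qed.
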